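(* Fix a positive integer $p$ and let $C_n$ be the $n\times n$ circulant matrix built from a Gaussian input sequence. Then $$\lim_{n\to\infty}\frac{\mathrm{Var}[\mathrm{Tr}(C_n^p)]}{n^{p+1}}=p!\sum_{s=0}^{p-1}f_p(s),$$ where $f_p$ is the density of $U_1+U_2+\cdots+U_p$, with $U_1,\dots,U_p$ i.i.d. uniform random variables on $[0,1]$, given on $[0,p]$ by $$f_p(x)=\frac{1}{(p-1)!}\sum_{k=0}^{\lfloor x\rfloor}(-1)^k\binom{p}{k}(x-k)^{p-1}.$$
   Context: A Gaussian input sequence $\{X_j: j\ge 0\}$ is a sequence of i.i.d. standard normal random variables. For $1\le i,j\le n$, the circulant matrix $C_n$ has $(i,j)$-th entry $X_{(j-i)\bmod n}$ (residues taken in $\{0,\dots,n-1\}$). Here $\lfloor x\rfloor$ is the largest integer not exceeding $x$, and $0^0=1$ (relevant only for $p=1$). The values $f_p(s)$ at integers are those given by the displayed formula. *)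

(* Defs.v *)
From HB Require Import structures.
From mathcomp Require Import all_boot all_order all_algebra finmap.
From mathcomp Require Import all_classical all_reals all_analysis.

Set Implicit Arguments.
Unset Strict Implicit.
Unset Printing Implicit Defensive.

Import Order.TTheory GRing.Theory Num.Theory.
Import numFieldNormedType.Exports.

Local Open Scope classical_set_scope.
Local Open Scope ring_scope.

Definition mutually_independent (d : measure_display) (T : measurableType d)
    (R : realType) (P : probability T R) (I : choiceType)
    (X : I -> {RV P >-> R}) : Prop :=
  forall (J : {fset I}) (A : I -> set R),
    (forall i, i \in J -> measurable (A i)) ->
    P (\bigcap_(i in [set` J]) (X i @^-1` A i)) =
    (\prod_(i <- J) P (X i @^-1` A i))%E.

Definition iid (d : measure_display) (T : measurableType d)
    (R : realType) (P : probability T R) (I : choiceType)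
    (X : I -> {RV P >-> R}) (mu : set R -> \bar R) : Prop :=
  mutually_independent X /\
  forall i (A : set R), measurable A -> distribution P (X i) A = mu A.

Definition is_density (d : measure_display) (T : measurableType d)
    (R : realType) (P : probability T R) (Z : T -> R) (f : R -> R) : Prop :=
  [/\ measurable_fun setT f,
      forall x, 0 <= f x &
      forall A : set R, measurable A ->
        P (Z @^-1` A) = (\int[lebesgue_measure]_(x in A) (f x)%:E)%E].

(* Indices run over 0, ..., n - 1 instead of 1, ..., n, which does not affect
   j - i; n is added before the (truncated) subtraction, as i < n. *)
Definition circulant (R : realType) (n : nat) (x : nat -> R) : 'M[R]_n :=
  \matrix_(i < n, j < n) x ((j + n - i) %% n)%N.

(* On [0, p], Num.truncn x is the floor of x. *)
Definition sum_uniform_pdf (R : realType) (p : nat) (x : R) : R :=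
  if 0 <= x <= p%:R then
    ((p.-1)`!%:R)^-1 *
    \sum_(0 <= k < (Num.truncn x).+1)
      (-1) ^+ k * 'C(p, k)%:R * (x - k%:R) ^+ p.-1
  else 0.

(* Main.v *)
Require Import Defs.
From HB Require Import structures.
From mathcomp Require Import all_boot all_order all_algebra finmap.
From mathcomp Require Import all_classical all_reals all_analysis.
From mathcomp Require Import measurable_realfun.
From mathcomp Require Import perm zify ring lra.

(** The group algebra of the residues modulo n contains the circulant matrix
    of x as the element with coordinates x, so the trace of its p-th power is
    n times the sum of the monomials x_(f 0) * ... * x_(f (p - 1)) over the
    tuples f of p residues with sum 0 ([tr_circulantX]).  The variance of this
    trace is therefore n ^ 2 times the sum, over the pairs (f, g) of such
    tuples, of the covariance of two monomials.  By independence a covariance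
    only depends on how often each residue occurs in f and in g
    ([variance_trace]), and three moments matter: 1, 0 and 1 in degrees
    0, 1 and 2.

    A residue that occurs once in f and g together makes the covariance vanish.
    If f is injective and g is a rearrangement of f, the covariance is 1; there
    are n ^ (p - 1) tuples with null sum, so these pairs contribute
    p! * n ^ (p - 1) up to lower order.  In all other pairs, which are called
    defective, too few residues are left free: either at most p - 1 residues
    occur and one equation relates them, or exactly p residues occur and the
    two equations are independent.  So there are only O(n ^ (p - 2)) defective
    pairs ([card_defective]), their covariances are bounded independently of n,
    and the variance divided by n ^ (p + 1) tends to p!
    ([sum_moment_cov_asymptotics], [variance_trace_cvg]).

    The density f_p is the p-th backward difference of x_+ ^ (p - 1) / (p - 1)!
    ([sum_uniform_pdfE]).  Summed over the integers 0, ..., p - 1 it telescopes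
    to the (p - 1)-st difference of a monomial of degree p - 1, which is
    constant; this gives the value 1 of the sum in the limit
    ([sum_sum_uniform_pdf]).

    The distribution function of a sum of p independent uniform variables is
    the p-th backward difference of x_+ ^ p / p!: one more variable replaces
    F by the function that maps x to the integral of F (x - u) over [0, 1],
    that is by the difference H x - H (x - 1) of a primitive H of F
    ([irwin_hall_cdfP]).  Its derivative is f_p ([iid_uniform_density]).

    Both halves use independence in the form of [rv_pair_law]: a variable and a
    fold (a sum, a product) of other variables of the family have a product
    law.  Fubini then gives the moments of monomials and the convolution with
    a uniform law. *)

Set Implicit Arguments.
Unset Strict Implicit.
Unset Printing Implicit Defensive.

Import Order.TTheory GRing.Theory Num.Theory.
Import numFieldNormedType.Exports.

Local Open Scope ring_scope.

(** * Counting pairs of tuples with null sums *)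

(** The exponent of [x v] in the monomial \prod_i x (f i). *)
Definition occ (p n : nat) (f : 'I_p -> 'I_n) (v : 'I_n) : nat :=
  #|[set i | f i == v]|.

Lemma occ_gt0 p n (f : 'I_p -> 'I_n) v : (0 < occ f v)%N = [exists i, f i == v].
Proof.
rewrite card_gt0; apply/set0Pn/existsP => -[i]; first by rewrite inE; exists i.
by move=> fi; exists i; rewrite inE.
Qed.

Lemma sum_occ p n (f : 'I_p -> 'I_n) : (\sum_v occ f v = p)%N.
Proof.
under eq_bigr do rewrite /occ -sum1dep_card.
rewrite (exchange_big_dep xpredT)//=.
transitivity (\sum_(i < p) 1)%N; last by rewrite sum1_card card_ord.
by apply: eq_bigr => i _; rewrite (big_pred1 (f i))// => v; rewrite /= eq_sym.
Qed.

Lemma occ_inj p n (f : 'I_p -> 'I_n) v : injective f -> (occ f v <= 1)%N.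
Proof.
move=> fI; apply/card_le1P => i; rewrite inE => /eqP fi j.
by rewrite !inE -fi (inj_eq fI).
Qed.

Lemma occ_gt1 p n (f : 'I_p -> 'I_n) i j : i != j -> f i = f j ->
  (1 < occ f (f i))%N.
Proof.
move=> ij fij; apply/card_gt1P; exists i, j; split => //; rewrite inE ?fij//.
Qed.

Section Decoding.
Variables (p k n : nat).
Let D := ('I_p + 'I_p)%type.

(** A pair of tuples, read as a function on ['I_p + 'I_p], is described by a
    code: each position holds one of [k] listed residues or one of two further
    residues [a] (coded [inr true]) and [b] (coded [inr false]), which the null
    sums will determine. *)
Definition decode (c : D -> 'I_k + bool) (w : 'I_k -> 'I_n) (a b : 'I_n) d :=
  match c d with inl i => w i | inr true => a | inr false => b end.

(** The shape of the linear system in [a] and [b] that makes it solvable: [a]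
    occurs on the left, and either [b] does not occur at all, or the right
    equation involves [b] but not [a], so that the system is triangular. *)
Definition solvable_code (c : D -> 'I_k + bool) :=
  (exists i, c (inl i) = inr true) /\
  ((forall d, c d <> inr false) \/
   (forall i, c (inr i) <> inr true) /\ exists i, c (inr i) = inr false).

(** If two sums over the same code agree and all letters but [x] have the same
    values, the values of [x] agree, since [x] has the same positive
    multiplicity in both sums. *)
Lemma solve_unknown (c : 'I_p -> 'I_k + bool) (x : 'I_k + bool)
    (y z : 'I_k + bool -> nat) :
  (forall i, c i <> x -> y (c i) = z (c i)) -> (exists i, c i = x) ->
  (\sum_i y (c i) = \sum_i z (c i))%N -> y x = z x.
Proof.
move=> yz [i0 ci0].
rewrite (bigID (fun i => c i == x))/= [in RHS](bigID (fun i => c i == x))/=.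
under eq_bigr => i /eqP -> do [].
under [in X in _ = X -> _]eq_bigr => i /eqP -> do [].
rewrite [X in (_ + X)%N](eq_bigr (fun i => z (c i))); last first.
  by move=> i /eqP; exact: yz.
move=> /addIn; rewrite !sum_nat_cond_const => /eqP; rewrite eqn_pmul2l.
  by move=> /eqP.
by rewrite card_gt0; apply/set0Pn; exists i0; rewrite inE ci0.
Qed.

Lemma decode_inj c w a b a' b' : solvable_code c ->
  (\sum_i (decode c w a b (inl i) : nat) = \sum_i decode c w a' b' (inl i))%N ->
  (\sum_i (decode c w a b (inr i) : nat) = \sum_i decode c w a' b' (inr i))%N ->
  decode c w a b =1 decode c w a' b'.
Proof.
pose y a b x : nat := match x with inl i => w i | inr true => a | inr false =>
  b end.
have E a1 b1 d : decode c w a1 b1 d = y a1 b1 (c d) :> nat.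
  by rewrite /decode /y; case: (c d) => // -[].
move=> [ea eb].
under eq_bigr do rewrite E; under [in RHS]eq_bigr do rewrite E.
move=> sL.
under eq_bigr do rewrite E; under [in RHS]eq_bigr do rewrite E.
move=> sR.
case: eb => [nob|[noa eb]].
  have : a = a' :> nat.
    apply: (solve_unknown (x := inr true) _ ea sL) => i.
    by rewrite /y; case: (c (inl i)) (nob (inl i)) => // -[].
  move=> /ord_inj aa' d; rewrite /decode aa'.
  by case: (c d) (nob d) => // -[].
have : b = b' :> nat.
  apply: (solve_unknown (x := inr false) _ eb sR) => i.
  by rewrite /y; case: (c (inr i)) (noa i) => // -[].
move=> /ord_inj bb'.
have : a = a' :> nat.
  apply: (solve_unknown (x := inr true) _ ea sL) => i.
  by rewrite /y bb'; case: (c (inl i)) => // -[].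
by move=> /ord_inj aa' d; rewrite /decode aa' bb'.
Qed.

End Decoding.

Section Counting.
Variables (p n' : nat).
Hypothesis p_gt0 : (0 < p)%N.
Let n := n'.+1.
Local Notation Fp := {ffun 'I_p -> 'I_n}.

Definition rearrangement (f g : Fp) := [exists s : 'S_p, g == [ffun i => f (s i)]].

Definition null_sum (f : Fp) := \sum_i f i == 0.

Definition null_sums : {set Fp} := [set f | null_sum f].

Definition matched_perm (f g : Fp) := injectiveb f && rearrangement f g.

(** The pairs that are neither matched nor discarded because a residue occurs
    only once. *)
Definition defective : {set Fp * Fp} :=
  [set fg : Fp * Fp | [&& null_sum fg.1, null_sum fg.2,
     [forall v : 'I_n, (occ fg.1 v + occ fg.2 v != 1)%N] & ~~ matched_perm fg.1
       fg.2]].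

Lemma null_sum_dvd (f : Fp) : null_sum f -> (n %| \sum_i (f i : nat))%N.
Proof.
move=> /eqP/(congr1 val)/=.
suff -> : val (\sum_i f i) = ((\sum_i (f i : nat)) %% n)%N by move/eqP.
by elim/big_ind2: _ => [|x1 x2 y1 y2 /= -> ->|i _]/=;
    rewrite ?mod0n ?modnDm// modn_small.
Qed.

(** Equality of residues is too weak to solve for an unknown that occurs
    several times; recording the sum of the representatives, a multiple of [n]
    with at most [p] possible values, turns the null sums into equations between
    natural numbers. *)
Lemma quotient_bound (f : Fp) : ((\sum_i (f i : nat)) %/ n < p)%N.
Proof.
rewrite ltn_divLR//; have p0 : (0 < p * n)%N by rewrite muln_gt0 p_gt0.
apply: (@leq_ltn_trans (\sum_(i < p) n')%N).
  by apply: leq_sum => i _; rewrite -ltnS.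
by rewrite sum_nat_const card_ord ltn_pmul2l.
Qed.

Definition quotient (f : Fp) : 'I_p := Ordinal (quotient_bound f).

Definition joint (fg : Fp * Fp) (d : 'I_p + 'I_p) : 'I_n :=
  match d with inl i => fg.1 i | inr i => fg.2 i end.

Lemma joint_inj fg fg' : joint fg =1 joint fg' -> fg = fg'.
Proof.
case: fg fg' => f g [f' g'] J.
by congr pair; apply/ffunP => i; [exact: (J (inl i))|exact: (J (inr i))].
Qed.

(** [a] and [b] can be solved for, and at most [p - 2] other residues occur. *)
Definition unknowns (fg : Fp * Fp) (a b : 'I_n) :=
  [/\ (exists i, fg.1 i = a),
      a = b \/ ((forall i, fg.2 i != a) /\ exists i, fg.2 i = b) &
      (#|[set v | [exists d, joint fg d == v]] :\: [set a; b]| + 2 <= p)%N].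

(** Each occurring residue occurs at least twice among the [2 * p] positions, so
    at most [p] residues occur. *)
Lemma defective_unknowns fg : fg \in defective -> exists a b, unknowns fg a b.
Proof.
case: fg => f g; rewrite inE/= => /and4P[_ _ /forallP no1 nperm].
pose V := [set v | [exists d, joint (f, g) d == v]].
have VE v : (v \in V) = (0 < occ f v + occ g v)%N.
  rewrite inE addn_gt0 !occ_gt0; apply/existsP/orP.
    by case=> -[i|i] /= fi; [left|right]; apply/existsP; exists i.
  by case=> /existsP[i fi]; [exists (inl i)|exists (inr i)].
have V2 v : v \in V -> (2 <= occ f v + occ g v)%N.
  by rewrite VE; move: (no1 v); case: (_ + _)%N => [|[|]].
have sumV : (\sum_(v in V) (occ f v + occ g v) = p + p)%N.
  rewrite -[X in (X + _)%N](sum_occ f) -[X in (_ + X)%N](sum_occ g) -big_split/=.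
  rewrite [RHS](bigID (mem V))/= [X in (_ + X)%N]big1 ?addn0// => v.
  by rewrite VE lt0n negbK => /eqP.
have cardV : (#|V| * 2 <= p + p)%N.
  by rewrite -sumV -sum_nat_const; apply: leq_sum.
have i0 : 'I_p by exact: (Ordinal p_gt0).
have fV i : f i \in V.
  by rewrite inE; apply/existsP; exists (inl i) => /=.
have gV i : g i \in V.
  by rewrite inE; apply/existsP; exists (inr i) => /=.
(* At most p - 1 residues: one unknown, in the equation of f, is enough. *)
have [Vp|pV] := ltnP #|V| p.
  exists (f i0), (f i0); split; [by exists i0|by left|].
  rewrite -/V finset.setUid; have := cardsD1 (f i0) V; rewrite fV; lia.
(* Exactly p residues, hence each of them occurs exactly twice. *)
have {}cardV : #|V| = p by lia.
have occ2 v : v \in V -> (occ f v + occ g v = 2)%N.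
  move=> vV; apply/eqP; rewrite eqn_leq V2// andbT leqNgt; apply/negP => gt2.
  have : (\sum_(v in V) 2 < \sum_(v in V) (occ f v + occ g v))%N.
    rewrite (bigD1 v)//= [in ltnRHS](bigD1 v)//= -addSn leq_add//.
    by apply: leq_sum => u /andP[uV _]; exact: V2.
  by rewrite sumV sum_nat_const; lia.
(* A residue that f takes twice is absent from g, so the system is triangular. *)
have [fI|/injectivePn[i [j ij fij]]] := boolP (injectiveb f); last first.
  have occga : occ g (f i) = 0%N.
    by have := occ2 _ (fV i); have := occ_gt1 ij fij; lia.
  have ga k : g k != f i.
    apply/negP => gk; suff : (0 < occ g (f i))%N by rewrite occga.
    by rewrite occ_gt0; apply/existsP; exists k.
  exists (f i), (g i0); split; [by exists i|by right; split => //; exists i0|].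
  rewrite -/V cardsD (finset.setIidPr _); last first.
    by apply/fintype.subsetP => v /set2P[]->.
  have : (1 < #|V|)%N.
    by apply/card_gt1P; exists (f i), (g i0); split => //; rewrite eq_sym.
  by rewrite cards2 eq_sym ga cardV /=; lia.
(* An injective f takes each of the p residues once, hence so does g. *)
move: nperm; rewrite /matched_perm fI/= => /existsP[].
move/injectiveP : fI => fI.
have fimV : f @: [set: 'I_p] = V.
  apply/eqP; rewrite eqEcard card_imset// cardsT card_ord cardV leqnn andbT.
  by apply/fintype.subsetP => v /imsetP[i _ ->].
have occf v : v \in V -> occ f v = 1%N.
  move=> vV; apply/eqP; rewrite eqn_leq occ_inj//= occ_gt0.
  by move: vV; rewrite -fimV => /imsetP[i _ ->]; apply/existsP; exists i.
have occg v : v \in V -> occ g v = 1%N.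
  by move=> vV; have := occ2 v vV; rewrite occf//; lia.
have gI : injective g.
  move=> i j gij; apply/eqP; apply/negPn/negP => ij.
  by have := occ_gt1 ij gij; rewrite occg.
have exs i : exists j, g i == f j.
  by have := gV i; rewrite -fimV => /imsetP[j _ ->]; exists j.
pose s i := xchoose (exs i).
have fs i : f (s i) = g i by exact/esym/eqP/(xchooseP (exs i)).
have sI : injective s by move=> i j /(congr1 f); rewrite !fs => /gI.
by exists (perm sI); apply/eqP/ffunP => i; rewrite ffunE permE fs.
Qed.

Local Notation k := (p - 2)%N.
Local Notation code := {ffun 'I_p + 'I_p -> 'I_k + bool}.

Lemma defective_code fg : fg \in defective ->
  exists cw : code * {ffun 'I_k -> 'I_n}, exists a b : 'I_n,
  solvable_code cw.1 /\ joint fg =1 decode cw.1 cw.2 a b.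
Proof.
move=> /defective_unknowns[a [b [[i0 fa] Hb cardW]]].
set V := [set v | _] in cardW; pose W := enum (V :\: [set a; b]).
have sW : (size W <= k)%N by rewrite /W -cardE; lia.
pose w : {ffun 'I_k -> 'I_n} := [ffun i => nth a W (i : 'I_k)].
have idx d : joint fg d \notin [set a; b] -> (index (joint fg d) W < k)%N.
  move=> dab; apply: leq_trans sW; rewrite index_mem mem_enum inE dab/=.
  by rewrite inE; apply/existsP; exists d.
pose c : code := [ffun d =>
  if joint fg d == a then inr true else if joint fg d == b then inr false else
  if insub (index (joint fg d) W) is Some i then inl i else inr true].
have cE d : joint fg d = decode c w a b d.
  rewrite /decode ffunE; case: eqVneq => [//|ja]; case: eqVneq => [//|jb].
  have jab : joint fg d \notin [set a; b] by rewrite !inE negb_or ja.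
  rewrite insubT ?idx// => idk; rewrite ffunE/= nth_index// mem_enum inE jab/=.
  by rewrite inE; apply/existsP; exists d.
exists (c, w), a, b; split; last exact: cE.
split; first by exists i0; rewrite ffunE/= fa eqxx.
case: Hb => [ab|[ga [i1 gb]]]; [left|right; split].
- by move=> d; rewrite ffunE -ab; case: eqVneq => // _; case: insub.
- move=> i; rewrite ffunE/= (negbTE (ga i)); case: ifPn => // gib.
  have iab : joint fg (inr i) \notin [set a; b].
    by rewrite in_set2 negb_or ga.
  by case: insubP => [//|]; rewrite (idx (inr i) iab).
- by exists i1; rewrite ffunE/= (negbTE (ga i1)) gb eqxx.
Qed.

Definition defective_const : nat := (#|code| * (p * p))%N.

(** A code, [p - 2] residues and the two quotients determine a defective pair;
    only the residues can be chosen in a number of ways that depends on [n]. *)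
Lemma card_defective : (#|defective| * n ^ 2 <= defective_const * n ^ p)%N.
Proof.
pose cw fg : code * {ffun 'I_k -> 'I_n} :=
  odflt ([ffun=> inr true], [ffun=> ord0])
    [pick cw : code * {ffun 'I_k -> 'I_n} |
      `[< solvable_code cw.1 /\ exists a b, joint fg =1 decode cw.1 cw.2 a b >]].
have cwP fg : fg \in defective -> solvable_code (cw fg).1 /\
    exists a b, joint fg =1 decode (cw fg).1 (cw fg).2 a b.
  move=> /defective_code[x [a [b [sx jx]]]]; rewrite /cw.
  case: pickP => [y /asboolP//|/(_ x)/asboolP[]]; split => //; by exists a, b.
pose F fg := (cw fg, (quotient fg.1, quotient fg.2)).
have FI : {in defective &, injective F}.
  move=> fg fg' dfg dfg' [Ecw Eq1 Eq2].
  have [sc [a [b jE]]] := cwP fg dfg; have [_ [a' [b' jE']]] := cwP fg' dfg'.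
  have /= sumE (f g : Fp) : null_sum f -> null_sum g ->
      ((\sum_i (f i : nat)) %/ n = (\sum_i (g i : nat)) %/ n)%N ->
      (\sum_i (f i : nat) = \sum_i (g i : nat))%N.
    by move=> /null_sum_dvd/divnK cf /null_sum_dvd/divnK cg e; rewrite -cf -cg e.
  move: dfg dfg'; rewrite !inE => /and4P[c1 c2 _ _] /and4P[c1' c2' _ _].
  rewrite Ecw in sc jE.
  have J : joint fg =1 joint fg'.
    move=> d; rewrite jE jE'; apply: decode_inj => //.
      under eq_bigr do rewrite -jE; under [in RHS]eq_bigr do rewrite -jE'.
      exact: sumE.
    under eq_bigr do rewrite -jE; under [in RHS]eq_bigr do rewrite -jE'.
    exact: sumE.
  exact: joint_inj.
have cardle : (#|defective| <= defective_const * n ^ k)%N.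
  rewrite -(card_in_imset FI); apply: leq_trans (max_card _) _.
  by rewrite !card_prod [#|{ffun 'I_k -> _}|]card_ffun !card_ord /defective_const
    mulnAC.
(* For p = 1 the truncated p - 2 is 0, but there is no defective pair. *)
have [p2|p2] := leqP 2 p.
  have -> : (n ^ p = n ^ k * n ^ 2)%N by rewrite -expnD subnK.
  by rewrite mulnA leq_mul2r cardle orbT.
suff -> : #|defective| = 0%N by [].
apply/eqP; rewrite -leqn0 leqNgt; apply/negP => /card_gt0P[fg].
by move=> /defective_unknowns[a [b [_ _]]]; lia.
Qed.

(** All fibres of the sum have the same cardinal, by translation of the first
    coordinate. *)
Lemma card_null_sums : (#|null_sums| * n = n ^ p)%N.
Proof.
pose e (c : 'I_n) : Fp := [ffun i : 'I_p => if i == Ordinal p_gt0 then c else 0].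
have sume c : \sum_i e c i = c.
  rewrite (bigD1 (Ordinal p_gt0))//= ffunE eqxx big1 ?addr0// => i.
  by rewrite ffunE => /negbTE ->.
have fiber c : #|[set f : Fp | \sum_i f i == c]| = #|null_sums|.
  pose sh (f : Fp) : Fp := [ffun i => f i + e c i].
  have shI : injective sh.
    by move=> f g /ffunP fg; apply/ffunP => i; have := fg i;
       rewrite !ffunE => /addIr.
  rewrite -[RHS](card_imset _ shI); congr #|pred_of_set _|; apply/finset.setP => g.
  rewrite inE; apply/idP/imsetP => [/eqP gc|[f]].
    exists [ffun i => g i - e c i].
      rewrite inE /null_sum; under eq_bigr do rewrite ffunE.
      by rewrite big_split/= sumrN sume gc subrr.
    by apply/ffunP => i; rewrite !ffunE subrK.
  rewrite inE /null_sum => /eqP f0 ->; under eq_bigr do rewrite ffunE.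
  by rewrite big_split/= sume f0 add0r.
rewrite mulnC -[X in (X * _)%N](card_ord n) -sum_nat_const.
under eq_bigr => c _ do rewrite -(fiber c) -sum1dep_card.
rewrite (exchange_big_dep xpredT)//=.
rewrite (eq_bigr (fun=> 1%N)) ?sum1_card ?card_ffun ?card_ord// => f _.
by rewrite (big_pred1 (\sum_i f i))// => c; rewrite /= eq_sym.
Qed.

End Counting.

Section CovarianceSum.
Variables (R : realFieldType) (m : nat -> R) (p : nat).
Hypotheses (m0 : m 0 = 1) (m1 : m 1 = 0) (m2 : m 2 = 1).
Hypothesis p_gt0 : (0 < p)%N.

(** The covariance of the monomials of [f] and [g] in independent variables whose
    [k]-th moments are [m k]. *)
Definition moment_cov n (f g : 'I_p -> 'I_n) : R :=
  \prod_v m (occ f v + occ g v) - (\prod_v m (occ f v)) * \prod_v m (occ g v).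

(* Since m 0 = 1, each moment m k of degree k at most 2 * p is at most B ^ k,
   and a product of such moments is bounded in terms of its total degree,
   whatever the number n of its factors. *)
Let B : R := 1 + \sum_(k < p.*2.+1) `|m k|.

Let B_ge1 : 1 <= B.
Proof. by rewrite lerDl sumr_ge0. Qed.

Let moment_le k : (k <= p.*2)%N -> `|m k| <= B ^+ k.
Proof.
move=> kp; case: k kp => [|k] kp; first by rewrite m0 normr1.
apply: (@le_trans _ _ B); last by rewrite ler_eXnr.
have kp1 : (k.+1 < p.*2.+1)%N by [].
rewrite /B (bigD1 (Ordinal kp1))//= addrCA lerDl addr_ge0// sumr_ge0//.
Qed.

Let prod_moment_le n (a : 'I_n -> nat) : (\sum_v a v <= p.*2)%N ->
  `|\prod_v m (a v)| <= B ^+ p.*2.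
Proof.
move=> ap; rewrite normr_prod.
apply: (@le_trans _ _ (\prod_v B ^+ a v)).
  apply: ler_prod => v _; rewrite normr_ge0/= moment_le//.
  by apply: leq_trans ap; rewrite (bigD1 v)//= leq_addr.
by rewrite prodrXr ler_weXn2l.
Qed.

Lemma moment_cov_le n (f g : 'I_p -> 'I_n) :
  `|moment_cov f g| <= B ^+ p.*2 *+ 2.
Proof.
rewrite mulr2n (le_trans (ler_normB _ _))// lerD//.
  by rewrite prod_moment_le// big_split/= !sum_occ addnn.
rewrite -big_split/= normr_prod.
apply: (@le_trans _ _ (\prod_v B ^+ (occ f v + occ g v))).
  apply: ler_prod => v _; rewrite normr_ge0/= normrM exprD.
  have le_occ (h : 'I_p -> 'I_n) : (occ h v <= p.*2)%N.
    apply: (@leq_trans (\sum_u occ h u)); first by rewrite (bigD1 v)//= leq_addr.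
    by rewrite sum_occ -addnn leq_addr.
  by rewrite ler_pM// moment_le.
by rewrite prodrXr big_split/= !sum_occ addnn.
Qed.

Lemma moment_cov_single n (f g : 'I_p -> 'I_n) v :
  (occ f v + occ g v)%N = 1%N -> moment_cov f g = 0.
Proof.
move=> fg1; rewrite /moment_cov (bigD1 v)//= fg1 m1 mul0r sub0r.
move: fg1; have [->|f0] := posnP (occ f v).
  rewrite add0n => g1; rewrite [X in _ * X](bigD1 v)//= g1 m1 mul0r mulr0.
  by rewrite oppr0.
move=> fg1; have f1 : occ f v = 1%N by lia.
by rewrite (bigD1 v)//= f1 m1 !mul0r oppr0.
Qed.

Lemma moment_cov_matched n' (f g : {ffun 'I_p -> 'I_n'.+1}) :
  matched_perm f g -> moment_cov f g = 1.
Proof.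
move=> /andP[/injectiveP fI /existsP[s /eqP gE]].
have occ_g v : occ g v = occ f v.
  have sI : {in [set i | f (s i) == v] &, injective s}.
    by move=> i j _ _; exact: perm_inj.
  rewrite /occ gE; under eq_finset do rewrite ffunE.
  rewrite -(card_in_imset sI); congr #|pred_of_set _|; apply/finset.setP => i.
  rewrite [RHS]inE; apply/imsetP/idP => [[j]|fi].
    by rewrite inE => /eqP <- ->.
  by exists ((s^-1)%g i); rewrite ?inE permKV.
have i0 : 'I_p := Ordinal p_gt0.
have fi0 : occ f (f i0) = 1%N.
  apply/eqP; rewrite eqn_leq occ_inj//= occ_gt0.
  by apply/existsP; exists i0.
rewrite /moment_cov [X in _ - X * _](bigD1 (f i0))//= fi0 m1 !mul0r subr0.
rewrite big1// => v _; rewrite occ_g.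
by have := occ_inj v fI; case: (occ f v) => [|[|]].
Qed.

Local Notation null n' := (null_sums p n').

Lemma null_sum_rearrangement n' (f g : {ffun 'I_p -> 'I_n'.+1}) :
  rearrangement f g -> null_sum g = null_sum f.
Proof.
move=> /existsP[s /eqP ->]; rewrite /null_sum; congr (_ == _).
rewrite [RHS](reindex_inj (@perm_inj _ s))/=.
by under eq_bigr do rewrite ffunE.
Qed.

Lemma card_rearrangement n' (f : {ffun 'I_p -> 'I_n'.+1}) : injective f ->
  #|[set g | rearrangement f g]| = p`!.
Proof.
move=> fI; pose F (s : 'S_p) : {ffun 'I_p -> 'I_n'.+1} := [ffun i => f (s i)].
have FI : injective F.
  by move=> s t /ffunP st; apply/permP => i; have := st i; rewrite !ffunE => /fI.
rewrite -card_Sn -cardsT.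
rewrite -(card_imset _ FI); congr #|pred_of_set _|; apply/finset.setP => g.
rewrite inE; apply/existsP/imsetP => [[s /eqP ->]|[s _ ->]]; first by exists s.
by exists s.
Qed.

(** Duplicating a tuple with null sum that is not injective makes it defective. *)
Lemma card_null_noninjective n' :
  (#|[set f in null n' | ~~ injectiveb f]| <= #|defective p n'|)%N.
Proof.
pose dup (f : {ffun 'I_p -> 'I_n'.+1}) := (f, f).
have dupI : injective dup by move=> f g [].
rewrite -(card_imset _ dupI);
  apply/subset_leq_card/fintype.subsetP => _ /imsetP[f + ->].
rewrite !inE => /andP[f0 fI]; rewrite /= f0/= /matched_perm (negbTE fI) andbT.
by apply/forallP => v; rewrite addnn -[1%N]/(true : nat); case: (occ f v).
Qed.

Lemma sum_moment_cov_split n' :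
  \sum_(f in null n') \sum_(g in null n') moment_cov f g =
  (p`! * #|[set f in null n' | injectiveb f]|)%:R +
  \sum_(fg in defective p n') moment_cov fg.1 fg.2.
Proof.
rewrite pair_big/= (bigID (fun fg => matched_perm fg.1 fg.2))/=; congr (_ + _).
  rewrite (eq_bigr (fun=> 1%:R)) => [|[f g] /andP[_]];
    last exact: moment_cov_matched.
  rewrite -natr_sum; congr (_%:R).
  transitivity (\sum_(f in [set f in null n' | injectiveb f])
      \sum_(g | rearrangement f g) 1)%N.
    rewrite pair_big_dep/=; apply: eq_bigl => -[f g]/=; rewrite !inE.
    rewrite /matched_perm; case: (boolP (rearrangement f g)); last first.
      by rewrite !andbF.
    by move=> /null_sum_rearrangement ->; rewrite !andbT andbb.
  rewrite (eq_bigr (fun=> p`!)) => [|f].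
    by rewrite sum_nat_const mulnC.
  by rewrite inE => /andP[_ /injectiveP fI];
    rewrite sum1dep_card card_rearrangement.
rewrite (bigID (fun fg : {ffun 'I_p -> 'I_n'.+1} * {ffun 'I_p -> 'I_n'.+1} =>
  [forall v, (occ fg.1 v + occ fg.2 v != 1)%N]))/=.
rewrite [X in _ + X]big1 ?addr0 => [|[f g]/= /andP[_]]; last first.
  by move=> /forallPn[v]; rewrite negbK => /eqP; exact: moment_cov_single.
by apply: eq_bigl => -[f g]; rewrite !inE/= -!andbA; do 2 congr (_ && _);
  rewrite andbC.
Qed.

(** The matched pairs give the main term up to the tuples that are not injective;
    these and the defective pairs are counted by [card_defective]. *)
Lemma sum_moment_cov_asymptotics : exists K : R, forall n',
  `|n'.+1%:R ^+ 2 * (\sum_(f in null n') \sum_(g in null n') moment_cov f g) -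
    p`!%:R * n'.+1%:R ^+ p.+1| <= K * n'.+1%:R ^+ p.
Proof.
pose K0 : R := p`!%:R + B ^+ p.*2 *+ 2.
exists (K0 * (defective_const p)%:R) => n'; set n : R := n'.+1%:R.
have K0_ge0 : 0 <= K0.
  by rewrite addr_ge0// mulrn_wge0// exprn_ge0// (le_trans _ B_ge1).
have -> : n ^+ p.+1 = n ^+ 2 * #|null n'|%:R.
  by rewrite expr2 -mulrA -natrM mulnC card_null_sums// natrX -exprS.
rewrite mulrCA -mulrBr normrM ger0_norm ?exprn_ge0//.
have dle : #|defective p n'|%:R * n ^+ 2 <= (defective_const p)%:R * n ^+ p.
  by rewrite -!natrX -!natrM ler_nat card_defective.
rewrite -mulrA (le_trans _ (ler_wpM2l K0_ge0 dle))//.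
rewrite [leLHS]mulrC [leRHS]mulrA ler_wpM2r ?exprn_ge0//.
rewrite sum_moment_cov_split.
have -> : #|null n'| = (#|[set f in null n' | injectiveb f]| +
                        #|[set f in null n' | ~~ injectiveb f]|)%N.
  rewrite -(cardsID [set f : {ffun 'I_p -> 'I_n'.+1} | injectiveb f]
    (null n')); congr (_ + _)%N.
    by apply: eq_card => f; rewrite !inE.
  by apply: eq_card => f; rewrite !inE andbC.
rewrite natrM natrD mulrDr opprD addrACA subrr add0r.
rewrite (le_trans (ler_normB _ _))// addrC mulrDl lerD//.
  by rewrite ger0_norm// ler_wpM2l// ler_nat card_null_noninjective.
rewrite mulr_natr -sumr_const (le_trans (ler_norm_sum _ _ _))//.
by apply: ler_sum => fg _; exact: moment_cov_le.
Qed.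

End CovarianceSum.

(** * The trace of a power of a circulant matrix *)

Section CirculantTrace.
Variables (R : realType) (n' : nat).
Local Notation n := n'.+1.

(** The matrix of the residue [v] in the regular representation of the residues
    modulo [n]; a circulant matrix is the image of a group algebra element. *)
Definition cyclic_shift (v : 'I_n) : 'M[R]_n := \matrix_(i, j) (j - i == v)%:R.

Lemma cyclic_shiftM u v : cyclic_shift u * cyclic_shift v = cyclic_shift (u + v).
Proof.
apply/matrixP => i j;
  rewrite !mxE (bigD1 (i + u))//= !mxE [i + u]addrC addrK eqxx mul1r.
rewrite big1 ?addr0 => [|k]; last first.
  by rewrite !mxE subr_eq => /negbTE ->; rewrite mul0r.
by rewrite !subr_eq addrCA addrA.
Qed.

Lemma prod_cyclic_shift p (f : 'I_p -> 'I_n) :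
  \prod_i cyclic_shift (f i) = cyclic_shift (\sum_i f i).
Proof.
elim/big_ind2 : _ => [|a u b v -> ->|//]; last exact: cyclic_shiftM.
apply/matrixP => i j; rewrite !mxE subr_eq0 eq_sym.
by [].
Qed.

Lemma circulantE (x : nat -> R) :
  circulant n x = \sum_(v < n) x v *: cyclic_shift v.
Proof.
apply/matrixP => i j; rewrite !mxE summxE (bigD1 (j - i))//= !mxE eqxx mulr1.
rewrite big1 ?addr0 => [|v]; last by rewrite !mxE eq_sym => /negbTE ->;
  rewrite mulr0.
by rewrite /= modnDmr addnBA// ltnW.
Qed.

(** Distributing the power over the sum of shifts leaves the shift by the sum of
    the tuple, whose trace is [n] if this sum is null and 0 otherwise. *)
Lemma tr_circulantX p (x : nat -> R) :
  \tr (circulant n x ^+ p) =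
  n%:R * \sum_(f : {ffun 'I_p -> 'I_n} | null_sum f) \prod_i x (f i).
Proof.
rewrite circulantE -{1}(card_ord p) -prodr_const bigA_distr_bigA/=.
under eq_bigr => f _ do rewrite scaler_prod prod_cyclic_shift.
rewrite raddf_sum/= mulr_sumr [RHS]big_mkcond; apply: eq_bigr => f _.
rewrite mxtraceZ.
have -> : \tr (cyclic_shift (\sum_i f i)) = (null_sum f)%:R *+ n.
  rewrite /mxtrace -[in RHS](card_ord n) -sumr_const.
  by apply: eq_bigr => i _; rewrite mxE subrr eq_sym.
case: (null_sum f); last by rewrite mul0rn mulr0.
by rewrite mulrC.
Qed.
End CirculantTrace.

Local Open Scope classical_set_scope.

(** * Joint laws of independent variables *)

Section IndependentFolds.
Context d (T : measurableType d) (R : realType) (P : probability T R).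
Variables (I : choiceType) (X : I -> {RV P >-> R}).
Variables (op : R -> R -> R) (idx : R) (g : I -> R -> R).
Hypothesis mop : measurable_fun setT (fun x : R * R => op x.1 x.2).
Hypothesis mg : forall i, measurable_fun setT (g i).

Definition fold_rv (s : seq I) (w : T) : R := \big[op/idx]_(i <- s) g i (X i w).

Lemma measurable_fold_rv s : measurable_fun setT (fold_rv s).
Proof.
elim: s => [|i s IH]; rewrite /fold_rv.
  by under eq_fun do rewrite big_nil; exact: measurable_cst.
under eq_fun do rewrite big_cons.
apply: (measurableT_comp mop (measurable_fun_pair _ IH)).
exact: measurableT_comp.
Qed.

HB.instance Definition _ s :=
  isMeasurableFun.Build _ _ _ _ (fold_rv s) (measurable_fold_rv s).

Definition rv_pair (i : I) (s : seq I) (w : T) : R * R := (X i w, fold_rv s w).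

Lemma measurable_rv_pair i s : measurable_fun setT (rv_pair i s).
Proof. exact: measurable_fun_pair. Qed.

HB.instance Definition _ i s :=
  isMeasurableFun.Build _ _ _ _ (rv_pair i s) (measurable_rv_pair i s).

(** Keeping an auxiliary event [E] makes the induction on the list of variables
    possible: [E] absorbs the condition on the first variable. *)
Definition indep_event (E : set T) (s : seq I) := forall A : I -> set R,
  (forall i, measurable (A i)) ->
  P (E `&` \big[setI/setT]_(i <- s) (X i @^-1` A i)) =
  (P E * \prod_(i <- s) P (X i @^-1` A i))%E.

Lemma measurable_rv_preimage i A : measurable A -> measurable (X i @^-1` A).
Proof. by move=> mA; rewrite -[X in measurable X]setTI;
  exact: measurable_funPT. Qed.

Lemma indep_event_cons E i s : i \notin s -> indep_event E (i :: s) ->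
  forall A, measurable A ->
    P (E `&` X i @^-1` A) = (P E * P (X i @^-1` A))%E /\
    indep_event (E `&` X i @^-1` A) s.
Proof.
move=> si indE A mA.
have EA : P (E `&` X i @^-1` A) = (P E * P (X i @^-1` A))%E.
  have := indE (fun j => if j == i then A else setT).
  rewrite !big_cons eqxx [X in _ `&` (_ `&` X)]big1_seq; last first.
    by move=> j /andP[_ js]; rewrite (negbTE (memPn si j js)) preimage_setT.
  rewrite [X in (_ * (_ * X))%E]big1_seq; last first.
    move=> j /andP[_ js]; rewrite (negbTE (memPn si j js)) preimage_setT.
    by rewrite probability_setT.
  by rewrite setIT mule1; apply => j; case: ifP.
split=> // B mB; rewrite EA -setIA -muleA.
have := indE (fun j => if j == i then A else B j).
rewrite !big_cons eqxx.
have eqs j : j \in s -> (if j == i then A else B j) = B j.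
  by move=> js; rewrite (negbTE (memPn si j js)).
rewrite (eq_big_seq (fun j => X j @^-1` B j)) => [|j /eqs -> //].
rewrite (eq_big_seq (fun j => P (X j @^-1` B j))) => [|j /eqs -> //].
by apply => j; case: ifP.
Qed.

(* The restriction of P to E sends the pair to a measure that agrees on
   rectangles with the product of the law of X i and of P E times the law of the
   fold. *)
Let rv_pair_law_step i s : uniq (i :: s) ->
    (forall E B, measurable E -> indep_event E s -> measurable B ->
       P (E `&` fold_rv s @^-1` B) = (P E * P (fold_rv s @^-1` B))%E) ->
  forall E C, measurable E -> indep_event E (i :: s) -> measurable C ->
    P (E `&` rv_pair i s @^-1` C) =
    (P E * (distribution P (X i) \x distribution P (fold_rv s))%E C)%E.
Proof.
move=> /= /andP[si us] IH E C mE indE mC.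
have PE0 : (0 <= fine (P E))%R by rewrite fine_ge0.
pose r : {nonneg R} := NngNum PE0.
have rE : r%:num%:E = P E by rewrite fineK// fin_num_measure.
pose m2 := mscale r (distribution P (fold_rv s)).
have m2E B : m2 B = (P E * distribution P (fold_rv s) B)%E.
  by rewrite -rE.
pose m' := pushforward (mrestr P mE) (rv_pair i s).
have : (distribution P (X i) \x m2)%E C = m' C.
  apply: (@product_measure_unique _ _ _ _ _ (distribution P (X i)) m2 m') => //.
  move=> A B mA mB; rewrite -[RHS]/(distribution P (X i) A * m2 B)%E m2E.
  have [EA indEA] := indep_event_cons si indE mA.
  transitivity (P ((E `&` X i @^-1` A) `&` fold_rv s @^-1` B)).
    by rewrite -setIA setIC.
  rewrite IH//; last by apply: measurableI => //; exact: measurable_rv_preimage.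
  by rewrite EA muleCA muleA.
rewrite /m' /pushforward /mrestr setIC => <-.
rewrite /product_measure1 -ge0_integralZl//=.
  by apply: eq_integral => x _; rewrite -m2E.
exact: measurable_fun_xsection.
Qed.

Hypothesis indX : mutually_independent X.

Lemma indep_eventT s : uniq s -> indep_event setT s.
Proof.
move=> us A mA; rewrite setTI probability_setT mul1e.
pose J := [fset i in s]%fset.
have sJ : perm_eq J s.
  by apply: uniq_perm => // i; rewrite !inE.
rewrite -(perm_big _ sJ)/= -[RHS](perm_big _ sJ)/= -(indX (fun i _ => mA i)).
congr (P _); rewrite bigcap_fset.
by [].
Qed.

(** An event independent of the variables is independent of their fold: both
    sides reduce to the product law of the first variable and the rest. *)
Lemma indep_fold s E B :
  uniq s -> measurable E -> indep_event E s -> measurable B ->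
  P (E `&` fold_rv s @^-1` B) = (P E * P (fold_rv s @^-1` B))%E.
Proof.
elim: s E B => [|i s IH] E B us mE indE mB.
  rewrite /fold_rv; under eq_fun do rewrite big_nil.
  rewrite preimage_cst; case: ifPn => _.
    by rewrite setIT probability_setT mule1.
  by rewrite setI0 measure0 mule0.
have /= /andP[si us'] := us.
pose C := [set x : R * R | B (op (g i x.1) x.2)].
have mC : measurable C.
  rewrite -[X in measurable X]setTI.
  have mgfst : measurable_fun setT (fun x : R * R => g i x.1).
    exact: (measurableT_comp (mg i) measurable_fst).
  exact: (measurableT_comp mop (measurable_fun_pair mgfst measurable_snd)).
have -> : fold_rv (i :: s) @^-1` B = rv_pair i s @^-1` C.
  by apply/funext => w; rewrite /preimage/= /fold_rv big_cons.
have step := rv_pair_law_step us (fun E B mE iE mB => IH E B us' mE iE mB).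
rewrite step//; congr (_ * _)%E.
by rewrite -(setTI (rv_pair i s @^-1` C)) step ?probability_setT ?mul1e//;
  exact: indep_eventT.
Qed.

Lemma rv_pair_law i s : uniq (i :: s) -> forall C, measurable C ->
  P (rv_pair i s @^-1` C) =
  (distribution P (X i) \x distribution P (fold_rv s))%E C.
Proof.
move=> us C mC; rewrite -(setTI (_ @^-1` C)) rv_pair_law_step//.
- by rewrite probability_setT mul1e.
- by move=> E B; apply: indep_fold; case/andP: us.
- exact: indep_eventT.
Qed.
End IndependentFolds.

Lemma integrable_distribution d d' (T : measurableType d) (T' : measurableType d')
    (R : realType) (P : probability T R) (X : {mfun T >-> T'}) (f : T' -> \bar R) :
  measurable_fun setT f -> P.-integrable setT (f \o X) ->
  (distribution P X).-integrable setT f.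
Proof.
move=> mf /integrableP[_ fX]; apply/integrableP; split => //.
rewrite (@ge0_integral_distribution _ _ _ _ _ _ _ (abse \o f))//=.
exact: (measurableT_comp (@abse_measurable R setT) mf).
Qed.

Section IntegralOfPair.
Context d d1 d2 (T : measurableType d) (T1 : measurableType d1)
  (T2 : measurableType d2) (R : realType) (P : probability T R).
Variables (U : {mfun T >-> T1}) (V : {mfun T >-> T2}).
Local Notation mu := (distribution P U).
Local Notation nu := (distribution P V).
Hypothesis joint_law : forall C : set (T1 * T2), measurable C ->
  P ((fun w => (U w, V w)) @^-1` C) = (mu \x nu)%E C.

Lemma ge0_integral_indep_pair (f : T1 * T2 -> \bar R) :
  measurable_fun setT f -> (forall x, 0 <= f x)%E ->
  (\int[P]_w f (U w, V w) = \int[mu]_x \int[nu]_y f (x, y))%E.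
Proof.
move=> mf f0; have mUV : measurable_fun setT (fun w => (U w, V w)).
  exact: measurable_fun_pair.
transitivity (\int[pushforward P (fun w => (U w, V w))]_x f x)%E.
  by rewrite ge0_integral_pushforward.
transitivity (\int[mu \x nu]_x f x)%E; last by rewrite fubini_tonelli1.
by apply: eq_measure_integral => A mA _; exact: joint_law.
Qed.

Lemma integral_indep_pair (f : T1 * T2 -> \bar R) :
  P.-integrable setT (fun w => f (U w, V w)) -> measurable_fun setT f ->
  (\int[P]_w f (U w, V w) = \int[mu]_x \int[nu]_y f (x, y))%E.
Proof.
move=> intf mf; have mUV : measurable_fun setT (fun w => (U w, V w)).
  exact: measurable_fun_pair.
have intmn : (mu \x nu)%E.-integrable setT f.
  apply/integrable12ltyP => //; move/integrableP: intf => [_].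
  rewrite (@ge0_integral_indep_pair (abse \o f))//=.
  exact: (measurableT_comp (@abse_measurable R setT) mf).
transitivity (\int[pushforward P (fun w => (U w, V w))]_x f x)%E.
  by rewrite integral_pushforward.
transitivity (\int[mu \x nu]_x f x)%E; last by rewrite -integral12_prod_meas1.
by apply: eq_measure_integral => A mA _; exact: joint_law.
Qed.

(** Tonelli gives the integrability of the product, and Fubini its mean. *)
Lemma expectation_indep_mul (a : T1 -> R) (b : T2 -> R) :
  measurable_fun setT a -> measurable_fun setT b ->
  P.-integrable setT (EFin \o (a \o U)) -> P.-integrable setT (EFin \o (b \o V)) ->
  P.-integrable setT (EFin \o (fun w => a (U w) * b (V w))) /\
  ('E_P[fun w => (a (U w) * b (V w))%R] = 'E_P[a \o U] * 'E_P[b \o V])%E.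
Proof.
move=> ma mb ia ib.
have mfst : measurable_fun setT (fun z : T1 * T2 => a z.1).
  exact: (measurableT_comp ma measurable_fst).
have msnd : measurable_fun setT (fun z : T1 * T2 => b z.2).
  exact: (measurableT_comp mb measurable_snd).
have mab : measurable_fun setT (fun z : T1 * T2 => (a z.1 * b z.2)%:E).
  by apply/measurable_EFinP; exact: measurable_funM.
have mna : measurable_fun setT (EFin \o a) by exact/measurable_EFinP.
have mnb : measurable_fun setT (EFin \o b) by exact/measurable_EFinP.
have ia' : mu.-integrable setT (EFin \o a).
  exact: (integrable_distribution mna ia).
have ib' : nu.-integrable setT (EFin \o b).
  exact: (integrable_distribution mnb ib).
have iab : P.-integrable setT (EFin \o (fun w => a (U w) * b (V w))).
  apply/integrableP; split.
    by apply/measurable_EFinP/measurable_funM; exact: measurableT_comp.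
  rewrite (@ge0_integral_indep_pair (fun z => `|(a z.1 * b z.2)%:E|%E))//=;
    last first.
    exact: (measurableT_comp (@abse_measurable R setT) mab).
  have /integrableP[_ aoo] := ia'; have /integrableP[_ boo] := ib'.
  under eq_integral => x _.
    under eq_integral do rewrite normrM EFinM.
    rewrite ge0_integralZl//; last first.
      exact: (measurableT_comp (@abse_measurable R setT) mnb).
    over.
  rewrite ge0_integralZr//.
  - apply: lte_mul_pinfty => //; first exact: integral_ge0.
    by rewrite ge0_fin_numE//; exact: integral_ge0.
  - exact: (measurableT_comp (@abse_measurable R setT) mna).
  - exact: integral_ge0.
split => //; rewrite unlock (integral_indep_pair _ mab)//=.
under eq_integral => x _.
  under eq_integral do rewrite EFinM.
  rewrite integralZl//; over.
have bfin : (\int[nu]_y (b y)%:E \is a fin_num)%E by exact: integrable_fin_num.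
rewrite -(fineK bfin) integralZr// fineK//.
by congr (_ * _)%E; rewrite integral_distribution.
Qed.

End IntegralOfPair.

Section ExpectationOfProducts.
Context d (T : measurableType d) (R : realType) (P : probability T R).
Variables (I : choiceType) (X : I -> {RV P >-> R}) (g : I -> R -> R).
Hypothesis mg : forall i, measurable_fun setT (g i).
Hypothesis indX : mutually_independent X.

Lemma expectation_prod (s : seq I) : uniq s ->
  (forall i, P.-integrable setT (EFin \o (g i \o X i))) ->
  P.-integrable setT (EFin \o (fun w => \prod_(i <- s) g i (X i w))) /\
  ('E_P[fun w => (\prod_(i <- s) g i (X i w))%R] =
    \prod_(i <- s) 'E_P[g i \o X i])%E.
Proof.
move=> + ig; elim: s => [_|i s IH us].
  under eq_fun do rewrite big_nil; rewrite big_nil; split.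
    exact: finite_measure_integrable_cst.
  exact: expectation_cst.
have mop : measurable_fun setT (fun x : R * R => x.1 * x.2).
  exact: measurable_funM.
have us' : uniq s by case/andP: us.
have [intS Es] := IH us'.
pose W := fold_rv X *%R 1 g s.
have mW : measurable_fun setT W := @measurable_fold_rv _ _ _ _ _ X _ 1 g mop mg s.
have WP : W \in mfun by exact: mem_set.
pose V : {mfun T >-> R} := mfun_Sub WP.
under eq_fun do rewrite big_cons; rewrite big_cons.
have [||||iab Eab] := @expectation_indep_mul _ _ _ _ _ _ _ P (X i) V _ (g i) id
  (mg i) => //.
  by move=> C mC; exact: (rv_pair_law 1 mop mg indX us mC).
by split => //; rewrite Eab Es.
Qed.

End ExpectationOfProducts.

(** * The variance of the trace in terms of moments *)

Section FiniteMean.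
Context d (T : measurableType d) (R : realType) (P : probability T R).

(** Integrability is carried along with the value, since the means of sums and
    multiples need it. *)
Definition has_mean (F : T -> R) (e : R) : Prop :=
  P.-integrable setT (EFin \o F) /\ ('E_P[F] = e%:E)%E.

Lemma has_mean_eq (F G : T -> R) e : F =1 G -> has_mean F e -> has_mean G e.
Proof. by move=> /funext ->. Qed.

Lemma has_mean_scale c F e : has_mean F e -> has_mean (fun w => c * F w) (c * e).
Proof.
move=> [iF EF]; split.
  by apply: eq_integrable (integrableZl measurableT c iF).
rewrite expectation.unlock; under eq_integral do rewrite EFinM.
by rewrite integralZl// EFinM -EF expectation.unlock.
Qed.

Lemma has_mean_sum (I : Type) (s : seq I) (Q : pred I) (F : I -> T -> R) e :
  (forall i, Q i -> has_mean (F i) (e i)) ->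
  has_mean (fun w => \sum_(i <- s | Q i) F i w) (\sum_(i <- s | Q i) e i).
Proof.
move=> Fe; elim: s => [|i s [iS ES]].
  apply: (@has_mean_eq (cst 0)); first by move=> w; rewrite big_nil.
  rewrite big_nil; split; last exact: expectation_cst.
  exact: finite_measure_integrable_cst.
rewrite big_cons; under eq_fun do rewrite big_cons.
have [Qi|nQi] := boolP (Q i); last by [].
have [iF EF] := Fe _ Qi; split.
  by apply: eq_integrable (integrableD measurableT iF iS).
rewrite expectation.unlock; under eq_integral do rewrite EFinD.
by rewrite integralD// EFinD -EF -ES expectation.unlock.
Qed.

Lemma variance_has_mean (F : T -> R) e e2 :
  has_mean F e -> has_mean (fun w => F w * F w) e2 ->
  ('V_P[F] = (e2 - e ^+ 2)%:E)%E.
Proof.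
move=> [iF EF] [iF2 EF2].
rewrite /variance covarianceE; try exact/Lfun1_integrable.
by rewrite (_ : F * F = fun w => F w * F w)// EF EF2 -EFinM -expr2 -EFinB.
Qed.

End FiniteMean.

Section TraceVariance.
Context d (T : measurableType d) (R : realType) (P : probability T R).
Variables (X : nat -> {RV P >-> R}) (m : nat -> R).
Hypothesis indX : mutually_independent X.
Hypothesis moments : forall i k, has_mean P (fun w => X i w ^+ k) (m k).

Lemma has_mean_monomial n (a : 'I_n -> nat) :
  has_mean P (fun w => \prod_(v < n) X v w ^+ a v) (\prod_v m (a v)).
Proof.
(* The variables are indexed by nat: extend the exponents by 0. *)
pose b i := if insub i is Some v then a v else 0%N.
have bE (v : 'I_n) : b v = a v by rewrite /b valK.
pose g i (x : R) := x ^+ b i.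
have mg i : measurable_fun setT (g i) by exact: measurable_funX.
have [|iE EE] := @expectation_prod _ _ _ P _ X g mg indX _ (iota_uniq 0 n).
  by move=> i; have [] := moments i (b i).
have prodE w : \prod_(v < n) X v w ^+ a v = \prod_(i <- iota 0 n) g i (X i w).
  rewrite -[X in iota _ X](subn0 n) -/(index_iota 0 n) big_mkord.
  by apply: eq_bigr => v _; rewrite /g bE.
split.
  by apply: eq_integrable iE => // w _ /=; rewrite prodE.
rewrite (_ : (fun w => _) = fun w => \prod_(i <- iota 0 n) g i (X i w)); last first.
  by apply/funext => w; rewrite prodE.
rewrite EE -[in LHS](subn0 n) -/(index_iota 0 n) big_mkord -prodEFin.
by apply: eq_bigr => v _; rewrite -bE; have [_ <-] := moments v (b v).
Qed.

Lemma prod_occ n p (f : 'I_p -> 'I_n) (x : 'I_n -> R) :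
  \prod_i x (f i) = \prod_v x v ^+ occ f v.
Proof.
rewrite (partition_big f xpredT)//=; apply: eq_bigr => v _.
rewrite (eq_bigr (fun=> x v)) => [|i /eqP -> //].
by rewrite prodr_const /occ cardsE.
Qed.

(** The exponents in the product of two monomials add up, and independence makes
    the mean of a monomial the product of the moments of its exponents. *)
Lemma variance_trace n' p :
  ('V_P[fun w => \tr (circulant n'.+1 (fun k => X k w) ^+ p)] =
   (n'.+1%:R ^+ 2 * \sum_(f in null_sums p n') \sum_(g in null_sums p n')
      moment_cov m f g)%:E)%E.
Proof.
pose F (f : {ffun 'I_p -> 'I_n'.+1}) w := \prod_i X (f i) w.
have meanF f : has_mean P (F f) (\prod_v m (occ f v)).
  by apply: has_mean_eq (has_mean_monomial _) => w; rewrite -prod_occ.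
have meanFF f g : has_mean P (fun w => F f w * F g w)
  (\prod_v m (occ f v + occ g v)).
  apply: has_mean_eq (has_mean_monomial _) => w; rewrite /F.
  rewrite (prod_occ f (fun v => X v w)) (prod_occ g (fun v => X v w)) -big_split/=.
  by apply: eq_bigr => v _; rewrite exprD.
pose n : R := n'.+1%:R.
have mean1 : has_mean P (fun w => n * \sum_(f in null_sums p n') F f w)
    (n * \sum_(f in null_sums p n') \prod_v m (occ f v)).
  by apply/has_mean_scale/has_mean_sum => f _; exact: meanF.
have mean2 : has_mean P (fun w => n ^+ 2 * \sum_(f in null_sums p n')
    \sum_(g in null_sums p n') F f w * F g w)
    (n ^+ 2 * \sum_(f in null_sums p n') \sum_(g in null_sums p n')
      \prod_v m (occ f v + occ g v)).
  by apply/has_mean_scale/has_mean_sum => f _; apply/has_mean_sum => g _;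
    exact: meanFF.
rewrite (_ : (fun w => _) = fun w => n * \sum_(f in null_sums p n') F f w);
  last first.
  apply/funext => w; rewrite tr_circulantX; congr (_ * _).
  by apply: eq_bigl => f; rewrite inE.
rewrite (variance_has_mean mean1 (has_mean_eq _ mean2)) => [|w]; last first.
  by rewrite mulrACA -expr2 big_distrlr.
congr EFin; rewrite exprMn -mulrBr; congr (_ * _).
rewrite expr2 big_distrlr -sumrB/=; apply: eq_bigr => f _.
by rewrite -sumrB.
Qed.
End TraceVariance.

(** * Moments of the standard normal law *)

Section Density.
Context d (T : measurableType d) (R : realType).
Variables (mu nu : {measure set T -> \bar R}) (q : T -> R).
Hypotheses (mq : measurable_fun setT q) (q0 : forall x, 0 <= q x).
Hypothesis nuE : forall A, measurable A -> nu A = (\int[mu]_(x in A) (q x)%:E)%E.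

Import HBNNSimple.

Let nnsfun_density (f : {nnsfun T >-> R}) :
  (\int[nu]_x (f x)%:E = \int[mu]_x ((f x)%:E * (q x)%:E))%E.
Proof.
have mq' : measurable_fun setT (EFin \o q) by exact/measurable_EFinP.
under [LHS]eq_integral do rewrite fimfunE -fsumEFin//.
rewrite [LHS]ge0_integral_fsum//; last 2 first.
  - by move=> r; exact/measurable_EFinP/measurableT_comp.
  - by move=> n x _; rewrite EFinM nnfun_muleindic_ge0.
under [RHS]eq_integral.
  move=> x xD; rewrite fimfunE -fsumEFin// ge0_mule_fsuml; last first.
    by move=> r; rewrite EFinM nnfun_muleindic_ge0.
  over.
have mind r : measurable_fun setT (fun x => (r * \1_(f @^-1` [set r]) x)%:E).
  by apply/measurable_EFinP; do 2 apply/measurableT_comp => //.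
rewrite [RHS]ge0_integral_fsum//; last 2 first.
  - by move=> r; exact: emeasurable_funM.
  - move=> r x _; rewrite mule_ge0 ?lee_fin//.
    by rewrite -lee_fin EFinM nnfun_muleindic_ge0.
apply: eq_fsbigr => r _.
rewrite integralZl_indic_nnsfun// integral_indic// setIT nuE//.
have [r0|r0] := leP 0 r; last first.
  rewrite preimage_nnfun0// integral_set0 mule0 integral0_eq// => x _.
  by rewrite indicE in_set0 mulr0 mul0e.
rewrite integral_mkcond -ge0_integralZl//=; last first.
- by move=> x _; rewrite patchE; case: ifP => // _; rewrite lee_fin.
- by apply/(measurable_restrictT _ _).1 => //; exact: measurable_funTS.
apply: eq_integral => x _; rewrite patchE indicE; case: ifP => _.
  by rewrite mulr1.
by rewrite mulr0 mul0e mule0.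
Qed.

(** A simple function is integrated level set by level set; monotone convergence
    extends the formula. *)
Lemma ge0_integral_density (f : T -> \bar R) :
  measurable_fun setT f -> (forall x, 0 <= f x)%E ->
  (\int[nu]_x f x = \int[mu]_x (f x * (q x)%:E))%E.
Proof.
move=> mf f0; have mq' : measurable_fun setT (EFin \o q) by exact/measurable_EFinP.
pose f_ := nnsfun_approx measurableT mf.
transitivity (lim (\int[nu]_x (f_ n x)%:E @[n --> \oo])%E).
  rewrite -monotone_convergence//=.
  - apply: eq_integral => x _; apply/esym/cvg_lim => //=.
    exact: cvg_nnsfun_approx.
  - by move=> n; exact/measurable_EFinP/measurable_funTS.
  - by move=> n x _; rewrite lee_fin.
  - by move=> x _ a b ab; rewrite lee_fin; exact/lefP/nd_nnsfun_approx.
under eq_fun do rewrite nnsfun_density.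
rewrite -monotone_convergence//=.
- apply: eq_integral => x _; apply/cvg_lim => //=.
  by apply: cvgeZr => //; exact: cvg_nnsfun_approx.
- by move=> n; apply: emeasurable_funM => //;
  exact/measurable_EFinP/measurable_funTS.
- by move=> n x _; rewrite mule_ge0// lee_fin.
- move=> x _ a b ab; rewrite lee_wpmul2r ?lee_fin//.
  exact/lefP/nd_nnsfun_approx.
Qed.

End Density.

Section NormalMoments.
Context (R : realType).
Local Notation mu := (@lebesgue_measure R).
Local Notation gauss := (normal_prob (0 : R) 1).
Local Notation phi := (normal_pdf (0 : R) 1).

Let phiE x : phi x = normal_peak 1 * expR (- (x ^+ 2 / 2)).
Proof. by rewrite normal_pdfE ?oner_eq0// /normal_fun subr0 expr1n mulNr. Qed.

Let mphi : measurable_fun setT phi := measurable_normal_pdf 0 1.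

Let phi_ge0 x : 0 <= phi x := normal_pdf_ge0 0 1 x.

Let cphi : continuous phi.
Proof. exact: (continuous_normal_pdf (oner_neq0 _)). Qed.

Lemma ge0_integral_gauss (f : R -> R) : measurable_fun setT f ->
  (forall x, 0 <= f x) ->
  (\int[gauss]_x (f x)%:E = \int[mu]_x (f x * phi x)%:E)%E.
Proof.
move=> mf f0; rewrite (@ge0_integral_density _ _ _ mu gauss phi)//.
by exact/measurable_EFinP.
Qed.

(** A power of |x| is absorbed by a part of the exponent, at the price of doubling
    the standard deviation. *)
Lemma expr_normal_pdf_le k : exists2 C : R, 0 <= C &
  forall x, `|x| ^+ k * phi x <= C * normal_pdf 0 2 x.
Proof.
pose a : R := 4 * k.+1%:R.
have a0 : 0 < a by rewrite mulr_gt0.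
have p20 : (0 : R) < normal_peak 2 by exact: normal_peak_gt0.
exists (a ^+ k * (normal_peak 1 / normal_peak 2)).
  by rewrite mulr_ge0 ?exprn_ge0 ?divr_ge0 ?normal_peak_ge0// ltW.
(* |x| <= a * expR t gives |x| ^+ k <= a ^+ k * expR (k * t), where the choice
   of a ensures k * t <= x ^+ 2 / 4. *)
move=> x; pose t := x ^+ 2 / a.
have t0 : 0 <= t by rewrite divr_ge0 ?sqr_ge0// ltW.
have xt : `|x| <= a * expR t.
  apply: (@le_trans _ _ (a * (1 + t))); last by rewrite ler_pM2l// expR_ge1Dx.
  rewrite mulrDr mulr1 /t mulrCA divff ?gt_eqF// mulr1 -real_normK ?num_real//.
  have : 4 <= a by rewrite /a ler_peMr// ler1n.
  by move: (normr_ge0 x); move: `|x| => y; nra.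
have xk : `|x| ^+ k <= a ^+ k * expR (x ^+ 2 / 4).
  apply: (@le_trans _ _ ((a * expR t) ^+ k));
    first by rewrite lerXn2r// nnegrE mulr_ge0 ?expR_ge0 ?ltW.
  rewrite exprMn ler_pM2l ?exprn_gt0// -expRM_natl ler_expR /t /a.
  have -> : k%:R * (x ^+ 2 / (4 * k.+1%:R)) = x ^+ 2 / 4 * (k%:R / k.+1%:R).
    by rewrite invfM; ring.
  by rewrite ler_piMr ?divr_ge0 ?sqr_ge0// ler_pdivrMr// mul1r ler_nat.
rewrite phiE normal_pdfE ?pnatr_eq0//
  -!mulrA (mulrA (normal_peak 2)^-1) mulVf ?gt_eqF// mul1r.
rewrite mulrCA [leRHS]mulrCA ler_wpM2l ?normal_peak_ge0//.
apply: (le_trans (ler_wpM2r (expR_ge0 _) xk)).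
rewrite -mulrA ler_pM2l ?exprn_gt0// -expRD ler_expR subr0.
have := sqr_ge0 x; rewrite mulNr; lra.
Qed.

Lemma integrable_expr_gauss k :
  gauss.-integrable setT (fun x => (x ^+ k)%:E).
Proof.
apply/integrableP; split; first exact/measurable_EFinP/measurable_funX.
rewrite (ge0_integral_gauss (f := fun x => `|x ^+ k|))//; last first.
  by apply: measurableT_comp => //; exact: measurable_funX.
have [C C0 kC] := expr_normal_pdf_le k.
apply: (@le_lt_trans _ _ (\int[mu]_x (C%:E * (normal_pdf 0 2 x)%:E))%E).
  apply: ge0_le_integral => //.
  - by move=> x _; rewrite lee_fin mulr_ge0.
  - apply/measurable_EFinP/measurable_funM => //.
    by apply: measurableT_comp => //; exact: measurable_funX.
  - apply: measurable_funeM; apply/measurable_EFinP.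
    exact: measurable_normal_pdf.
  - by move=> x _; rewrite -EFinM lee_fin normrX kC.
rewrite integralZl//; last exact: integrable_normal_pdf.
by rewrite integral_normal_pdf mule1 ltry.
Qed.

Definition gaussian_moment k : R := fine (\int[gauss]_x (x ^+ k)%:E)%E.

Lemma gaussian_moment0 : gaussian_moment 0 = 1.
Proof.
rewrite /gaussian_moment; under eq_integral do rewrite expr0.
rewrite (_ : (\int[gauss]_x 1%:E)%E = 1%E)// integral_cst// mul1e.
exact: integral_normal_pdf.
Qed.

Lemma integral_expr_gauss k :
  (\int[gauss]_x (x ^+ k)%:E = (gaussian_moment k)%:E)%E.
Proof. by rewrite fineK// integrable_fin_num// integrable_expr_gauss. Qed.

Let phiN x : phi (- x) = phi x. Proof. by rewrite !phiE sqrrN. Qed.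

(** By parity E|X| is twice the integral over the positive half-line, and so is
    E(X + |X|) because X + |X| vanishes on the negative half-line. *)
Lemma gaussian_moment1 : gaussian_moment 1 = 0.
Proof.
have iX : gauss.-integrable setT (EFin \o id).
  by apply: eq_integrable (integrable_expr_gauss 1) => // x _; rewrite expr1.
have iN : gauss.-integrable setT (EFin \o (fun x => `|x|)) by exact:
  integrable_norm iX.
pose A := (\int[mu]_(x in [set x | (0 <= x)%R]) (`|x| * phi x)%:E)%E.
have EN : (\int[gauss]_x `|x|%:E = 2%:E * A)%E.
  rewrite ge0_integral_gauss// ge0_symfun_integralT//.
  - by move=> x; rewrite mulr_ge0.
  - by move=> x; apply: cvgM; [exact: norm_continuous|exact: cphi].
  - by move=> x /=; rewrite normrN phiN.
have EXN : (\int[gauss]_x (x + `|x|)%:E = 2%:E * A)%E.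
  rewrite ge0_integral_gauss; last 2 first.
  - exact: measurable_funD.
  - by move=> x; rewrite -lerBlDl sub0r -normrN ler_norm.
  rewrite /A -ge0_integralZl//; last 3 first.
  - by rewrite -set_itvcy.
  - by apply/measurable_EFinP/measurable_funTS/measurable_funM.
  - by move=> x _; rewrite lee_fin mulr_ge0.
  rewrite [RHS]integral_mkcond; apply: eq_integral => x _.
  rewrite patchE; case: ifPn; rewrite ?inE ?notin_setE/= => x0.
    by rewrite ger0_norm// -EFinM; congr EFin; lra.
  by rewrite ler0_norm ?subrr ?mul0r//; apply/ltW; rewrite ltNge; apply/negP.
have EX : (\int[gauss]_x (id x)%:E \is a fin_num)%E by exact: integrable_fin_num.
have EA : (2%:E * A \is a fin_num)%E by rewrite -EN;
  exact: (integrable_fin_num measurableT iN).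
move: EXN; under eq_integral do rewrite EFinD.
rewrite integralD_EFin// EN /gaussian_moment.
under [in X in _ -> X]eq_integral do rewrite expr1.
move: EX EA; case: (\int[gauss]_x (id x)%:E)%E => // a _.
by case: (_ * _)%E => // b _ [] ab /=; lra.
Qed.

(* (x ^+ 2 - 1) * phi x is the derivative of - x * phi x, which vanishes at 0 and
   at infinity; so x ^+ 2 * phi x and phi x have the same integral on the
   positive half-line. *)
Let hermite2 x : R := (x ^+ 2 - 1) * phi x.
Let hermite1 x : R := - (x * phi x).

Let is_derive_hermite1 (x : R) : is_derive x 1 hermite1 (hermite2 x).
Proof.
have dphi : is_derive x 1 (fun y : R => normal_peak 1 * expR (- (y ^+ 2 / 2)))
    (- (x * phi x)).
  apply: is_derive_eq; rewrite phiE /GRing.scale/=; by field.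
rewrite /hermite1 (_ : (fun x => _) =
  - (id * (fun y : R => normal_peak 1 * expR (- (y ^+ 2 / 2))))); last first.
  by apply/funext => y /=; rewrite phiE.
apply: is_derive_eq. rewrite /hermite2 phiE /GRing.scale/=; ring.
Qed.

Let chermite2 : continuous hermite2.
Proof.
move=> x; apply: cvgM; last exact: cphi.
by apply: cvgB; [exact: sqr_continuous|exact: cvg_cst].
Qed.

Let hermite1_cvg0 : hermite1 x @[x --> +oo] --> (0 : R).
Proof.
pose c : R := normal_peak 1 * 2.
apply: (@squeeze_cvgr _ _ _ _ (fun x => - c * x^-1) (cst 0)).
- near=> x; have x0 : 0 < x by near: x; exact: nbhs_pinfty_gt.
  rewrite /hermite1 oppr_le0 mulr_ge0 ?(ltW x0)// andbT mulNr lerN2 phiE.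
  rewrite mulrCA /c -[leRHS]mulrA ler_wpM2l ?normal_peak_ge0// expRN.
  rewrite ler_pdivlMr// mulrAC ler_pdivrMr ?expR_gt0//.
  by have := expR_ge1Dx (x ^+ 2 / 2); lra.
- rewrite -[X in _ --> X](mulr0 (- c)); apply: cvgM; first exact: cvg_cst.
  by apply/gtr0_cvgV0 => //; near=> x; near: x; exact: nbhs_pinfty_gt.
- exact: cvg_cst.
Unshelve. all: end_near. Qed.

Let integral_hermite2 :
  (\int[mu]_(x in [set x | (0 <= x)%R]) (hermite2 x)%:E = 0)%E.
Proof.
have chermite1 : continuous hermite1.
  move=> x; apply/differentiable_continuous/derivable1_diffP.
  by have [] := is_derive_hermite1 x.
have der x : derivable hermite1 x 1 by have [] := is_derive_hermite1 x.
have dE x : hermite1^`() x = hermite2 x.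
  by rewrite derive1E; have [_ ->] := is_derive_hermite1 x.
have mh : measurable_fun setT (EFin \o hermite2).
  by apply/measurable_EFinP; exact: continuous_measurable_fun.
(* The sign of hermite2 changes at 1, and improper integration of a derivative
   asks for a constant sign. *)
have H01 : (\int[mu]_(x in `[0%R, 1%R]) (hermite2 x)%:E =
  (hermite1 1 - hermite1 0)%:E)%E.
  rewrite EFinB; apply: continuous_FTC2 => //.
  - exact: continuous_subspaceT.
  - split => //.
      exact/cvg_at_right_filter/chermite1.
    exact/cvg_at_left_filter/chermite1.
have H1y : (\int[mu]_(x in `[1%R, +oo[) (hermite2 x)%:E = (0 - hermite1 1)%:E)%E.
  rewrite EFinB; apply: ge0_continuous_FTC2y => //.
  - move=> x x1; rewrite mulr_ge0// subr_ge0 expr2.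
    by rewrite (le_trans x1)// ler_peMr// (le_trans _ x1).
  - exact: continuous_subspaceT.
  - exact/cvg_at_right_filter/chermite1.
rewrite -set_itvcy (@itv_bndbnd_setU _ _ _ (BLeft 1)) ?bnd_simp//.
rewrite integral_setU//; last 2 first.
- exact: measurable_funTS.
- apply/disj_setPS => y [/=]; rewrite 2!in_itv/= => /andP[_ y1] /andP[].
  by rewrite leNgt y1.
rewrite integral_itv_bndo_bndc; last exact: measurable_funTS.
rewrite H01 H1y -EFinD; congr EFin; rewrite /hermite1 mul0r; ring.
Qed.

Lemma gaussian_moment2 : gaussian_moment 2 = 1.
Proof.
rewrite /gaussian_moment ge0_integral_gauss//; last first.
  by move=> x; rewrite sqr_ge0.
rewrite ge0_symfun_integralT; last 3 first.
- by move=> x; rewrite mulr_ge0// sqr_ge0.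
- by move=> x; apply: cvgM; [exact: sqr_continuous|exact: cphi].
- by move=> x /=; rewrite sqrrN phiN.
have := integral_normal_pdf (0 : R) 1.
rewrite ge0_symfun_integralT//; last by move=> x /=; rewrite phiN.
have mH : measurable [set x : R | 0 <= x] by rewrite -set_itvcy.
have iphi : mu.-integrable [set x : R | 0 <= x] (EFin \o phi).
  by apply: (integrableS measurableT) => //; exact: integrable_normal_pdf.
have ix2 : mu.-integrable [set x : R | 0 <= x] (EFin \o (fun x => x ^+ 2 * phi x)).
  apply: (integrableS measurableT) => //.
  have m2 : measurable_fun setT (fun x : R => x ^+ 2) by exact: measurable_funX.
  apply/integrableP; split; first exact/measurable_EFinP/measurable_funM.
  have /integrableP[_] := integrable_expr_gauss 2.
  rewrite (ge0_integral_gauss (f := fun x => `|x ^+ 2|))//;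
    last exact: measurableT_comp.
  apply: le_lt_trans; rewrite le_eqVlt; apply/orP; left; apply/eqP.
  by apply: eq_integral => x _ /=; rewrite normrM (ger0_norm (phi_ge0 x)).
suff -> : (\int[mu]_(x in [set x | (0 <= x)%R]) (x ^+ 2 * phi x)%:E =
  \int[mu]_(x in [set x | (0 <= x)%R]) (phi x)%:E)%E by move=> ->.
have := integral_hermite2; rewrite /hermite2.
under eq_integral do rewrite mulrBl mul1r EFinB.
rewrite integralB_EFin// => /eqP.
rewrite sube_eq ?add0e; first by move=> /eqP.
  exact: integrable_fin_num.
by rewrite fin_num_adde_defl// integrable_fin_num.
Qed.

End NormalMoments.

Lemma has_mean_gaussian d (T : measurableType d) (R : realType)
    (P : probability T R) (X : {RV P >-> R}) k :
  (forall A, measurable A -> distribution P X A = normal_prob (0 : R) 1 A) ->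
  has_mean P (fun w => X w ^+ k) (gaussian_moment R k).
Proof.
(* Y is X with values in the measurable structure that carries the Lebesgue
   measure, so that its law can be compared with the normal law. *)
move=> XN; pose Y : T -> measurableTypeR R := X.
have mY : measurable_fun setT Y by exact: (measurable_funPT X).
have lawE (f : measurableTypeR R -> \bar R) :
    (\int[pushforward P Y]_x f x = \int[normal_prob (0 : R) 1]_x f x)%E.
  by apply: eq_measure_integral => A mA _; exact: XN.
have mk : measurable_fun setT (fun x : measurableTypeR R => (x ^+ k)%:E).
  by apply/measurable_EFinP; exact: measurable_funX.
have iY : P.-integrable setT ((fun x : measurableTypeR R => (x ^+ k)%:E) \o Y).
  apply/integrableP; split; first exact: measurableT_comp.
  have /integrableP[_] := integrable_expr_gauss R k; rewrite -lawE.
  by rewrite ge0_integral_pushforward//; exact: measurableT_comp.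
split => //; rewrite -integral_expr_gauss -lawE expectation.unlock.
by rewrite integral_pushforward.
Qed.

(** * Finite differences of truncated powers *)

Section FiniteDifferences.
Variable R : realType.
Implicit Types (F G : R -> R) (x : R).

Definition nabla F x : R := F x - F (x - 1).

Lemma iter_nabla_sum p (I : Type) (s : seq I) (c : I -> R) (F : I -> R -> R) :
  iter p nabla (fun x => \sum_(i <- s) c i * F i x) =
  (fun x => \sum_(i <- s) c i * iter p nabla (F i) x).
Proof.
elim: p => [//|p IH]; rewrite iterS IH; apply/funext => x.
rewrite /nabla -sumrB; apply: eq_bigr => i _.
by rewrite -mulrBr.
Qed.

Lemma iter_nablaE p F x :
  iter p nabla F x = \sum_(0 <= k < p.+1) (-1) ^+ k * 'C(p, k)%:R * F (x - k%:R).
Proof.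
elim: p x => [|p IH] x.
  by rewrite big_nat1 expr0 bin0 !mul1r subr0.
rewrite iterS /nabla !IH [RHS]big_nat_recl// bin0 expr0 !mul1r.
under [in RHS]eq_bigr do rewrite binS natrD mulrDr mulrDl.
rewrite big_split/= addrA; congr (_ + _).
  rewrite big_nat_recl// bin0 expr0 !mul1r; congr (_ + _).
  by rewrite big_nat_recr//= bin_small// mulr0 mul0r addr0.
rewrite -sumrN; apply: eq_bigr => k _.
have -> : x - 1 - k%:R = x - k.+1%:R by rewrite -natr1; ring.
by rewrite exprS; ring.
Qed.

Lemma eq_iter_nabla p F G x :
  (forall k, (k <= p)%N -> F (x - k%:R) = G (x - k%:R)) ->
  iter p nabla F x = iter p nabla G x.
Proof.
move=> FG; rewrite !iter_nablaE; apply: eq_big_nat => k /andP[_ kp].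
by rewrite FG.
Qed.

(** By the binomial formula, [nabla] lowers the degree by one and multiplies the
    leading coefficient by the degree. *)
Lemma iter_nabla_expr p j x : (j <= p)%N ->
  iter p nabla (fun y => y ^+ j) x = if j == p then p`!%:R else 0.
Proof.
elim: p j x => [|p IH] j x.
  by rewrite leqn0 => /eqP ->; rewrite /= expr0.
move=> jp; rewrite iterSr.
have -> : nabla (fun y => y ^+ j) = fun y =>
    \sum_(i < j) ((-1) ^+ i * 'C(j, i.+1)%:R) * y ^+ (j - i.+1).
  apply/funext => y; rewrite /nabla exprBn big_ord_recl/= subn0 bin0 expr1n.
  rewrite expr0 !(mul1r, mulr1, mulr1n) opprD addrA subrr add0r -sumrN.
  apply: eq_bigr => i _; rewrite expr1n mulr1 /bump/= add1n exprS.
  by rewrite -mulr_natr; ring.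
rewrite iter_nabla_sum.
case: j jp => [_|j]; first by rewrite big_ord0.
rewrite ltnS eqSS => jp; rewrite big_ord_recl/= expr0 mul1r subn1/= IH// bin1.
rewrite big1 ?addr0 => [|i _].
  by case: eqP => [->|_]; rewrite ?mulr0// -natrM.
rewrite IH; last by rewrite /bump/=; lia.
case: eqP; last by rewrite mulr0.
by rewrite /bump/=; move: (ltn_ord i); lia.
Qed.

(** The truncated power x_+ ^ m / m!, with the convention x_+ ^ 0 = 1 for
    0 <= x. *)
Definition tpow m x : R := if 0 <= x then x ^+ m / m`!%:R else 0.

(** To the right of [p] all the truncated powers in the difference are powers. *)
Lemma iter_nabla_tpow p m x : (m <= p)%N -> p%:R <= x ->
  iter p nabla (tpow m) x = (m == p)%:R.
Proof.
move=> mp px; rewrite (@eq_iter_nabla _ _ (fun y =>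
    \sum_(i <- [:: tt]) m`!%:R^-1 * y ^+ m)) => [|k kp]; last first.
  rewrite big_seq1 /tpow subr_ge0 (le_trans _ px) ?ler_nat//.
  by rewrite mulrC.
rewrite iter_nabla_sum big_seq1 iter_nabla_expr//.
case: eqP => [->|_]; last by rewrite mulr0.
by rewrite mulVf// pnatr_eq0 -lt0n fact_gt0.
Qed.

Lemma iter_nabla_tpow_neg p m x : x < 0 -> iter p nabla (tpow m) x = 0.
Proof.
move=> x0; rewrite iter_nablaE big1// => k _; rewrite /tpow.
by rewrite leNgt subr_lt0 (lt_le_trans x0)// mulr0.
Qed.

(** Truncation of the powers replaces the bound on [k] in the sum, and to the
    right of [p] the difference of order [p] of a polynomial of degree [p - 1]
    is null. *)
Lemma sum_uniform_pdfE p x : (0 < p)%N ->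
  sum_uniform_pdf p x = iter p nabla (tpow p.-1) x.
Proof.
move=> p0; rewrite /sum_uniform_pdf; case: ifPn => [/andP[x0 xp]|].
  have tp : (Num.truncn x <= p)%N.
    by rewrite -(ler_nat R) (le_trans _ xp)// truncn_le.
  rewrite iter_nablaE mulr_sumr (@big_cat_nat _ _ _ (Num.truncn x).+1 _ p.+1)//=.
  rewrite [X in _ = _ + X]big1_seq ?addr0; last first.
    move=> k /andP[_]; rewrite mem_index_iota => /andP[xk _].
    rewrite /tpow subr_ge0 leNgt (lt_le_trans (truncnS_gt x)) ?ler_nat//=.
    by rewrite mulr0.
  apply: eq_big_nat => k /andP[_ kx]; rewrite /tpow subr_ge0.
  have -> : k%:R <= x by rewrite -truncn_ge_nat.
  by rewrite mulrC -!mulrA.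
rewrite negb_and -!ltNge => /orP[x0|px]; first by rewrite iter_nabla_tpow_neg.
rewrite iter_nabla_tpow ?leq_pred ?(ltW px)//.
by case: p p0 {px} => //= p _; rewrite ltn_eqF.
Qed.

(** The outermost difference telescopes, from - 1 where all truncated powers
    vanish to [p - 1] where they are powers. *)
Lemma sum_sum_uniform_pdf p : (0 < p)%N ->
  \sum_(0 <= s < p) sum_uniform_pdf p s%:R = 1 :> R.
Proof.
move=> p0; under eq_bigr do rewrite sum_uniform_pdfE//.
case: p p0 => // p _; set G := iter p nabla (tpow p).
have telescope n : \sum_(0 <= s < n.+1) iter p.+1 nabla (tpow p) s%:R = G n%:R.
  elim: n => [|n IH]; last first.
    by rewrite big_nat_recr//= IH -/G /nabla -[n.+1%:R]natr1 addrK addrC subrK.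
  rewrite big_nat1 /= -/G /nabla mulr0n sub0r.
  by rewrite [G (- 1)]iter_nabla_tpow_neg ?subr0// oppr_lt0.
by rewrite telescope /G iter_nabla_tpow ?eqxx.
Qed.

End FiniteDifferences.
Arguments nabla {R}.
Arguments tpow {R}.

Section TruncatedPowers.
Variable R : realType.
Implicit Types (F G : R -> R) (x : R).

Let tpow_quotient_le m (h : R) : `|h| <= 1 -> `|h^-1 * tpow m.+2 h| <= `|h|.
Proof.
move=> h1; rewrite /tpow; case: ifPn => [h0|_]; last by rewrite mulr0 normr0.
have [->|hn0] := eqVneq h 0; first by rewrite invr0 mul0r normr0.
rewrite mulrA (exprS h m.+1) mulrA mulVf// mul1r normrM normrX normfV.
rewrite ler_pdivrMr ?normr_gt0 ?pnatr_eq0 -?lt0n ?fact_gt0//.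
apply: (@le_trans _ _ `|h|); first by rewrite exprS ler_piMr// exprn_ile1.
by rewrite ler_peMr// ger0_norm// ler1n fact_gt0.
Qed.

(** Away from 0 the truncated power is locally 0 or a power; at 0 its difference
    quotient at [h] is at most |h|. *)
Lemma is_derive_tpow m x : is_derive x 1 (@tpow R m.+2) (tpow m.+1 x).
Proof.
have [x0|x0|->] := ltgtP x 0.
- have -> : tpow m.+1 x = 0 by rewrite /tpow leNgt x0.
  apply: (@near_eq_is_derive _ _ _ (cst 0)).
  near=> y; rewrite /tpow leNgt; have -> // : y < 0.
  by near: y; exact: lt_nbhsl.
- have -> : tpow m.+1 x = x ^+ m.+1 / m.+1`!%:R by rewrite /tpow ltW.
  apply: (@near_eq_is_derive _ _ _ (fun y : R => y ^+ m.+2 / m.+2`!%:R : R)).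
    near=> y; rewrite /tpow; have -> // : 0 <= y.
    by apply/ltW; near: y; exact: lt_nbhsr.
  have h2 : m.+2`!%:R = m.+2%:R * m.+1`!%:R :> R by rewrite -natrM factS.
  have h1 : m.+1`!%:R != 0 :> R by rewrite pnatr_eq0 -lt0n fact_gt0.
  have -> : (fun y : R => y ^+ m.+2 / m.+2`!%:R : R) =
      m.+2`!%:R^-1 \*: (id ^+ m.+2 : R -> R).
    by apply/funext => y; rewrite exprfctE mulrC.
  apply: (is_derive_eq (is_deriveZ _ (is_deriveX m.+2 (is_derive_id x (1 : R))))).
  rewrite /GRing.scale/= h2 mulr1 invfM mulrA mulrC -!mulrA; congr (_ * _).
  by rewrite mulrCA mulVf ?mulr1 ?pnatr_eq0.
- have -> : tpow m.+1 0 = 0 :> R by rewrite /tpow lexx expr0n mul0r.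
  have t0 : tpow m.+2 0 = 0 :> R by rewrite /tpow lexx expr0n mul0r.
  have cv : (fun h => h^-1 *: ((@tpow R m.+2 \o shift 0) (h *: 1) - tpow m.+2 0))
      @ (0 : R)^' --> (0 : R).
    apply/cvgr0Pnorm_le => e e0; near=> h.
    rewrite t0 subr0 /= addr0 /GRing.scale/= mulr1.
    have h1 : `|h| <= 1.
      by near: h; apply: dnbhs0_le.
    apply: (le_trans (tpow_quotient_le m h1)).
    by near: h; exact: dnbhs0_le.
  by apply: DeriveDef; [exact: cvgP cv|exact: cvg_lim cv].
Unshelve. all: end_near. Qed.

Lemma continuous_tpow m : continuous (@tpow R m.+1).
Proof.
case: m => [|m] x; last first.
  apply/differentiable_continuous/derivable1_diffP.
  by have [] := is_derive_tpow m x.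
have -> : @tpow R 1 = fun y => 2^-1 * (y + `|y|).
  apply/funext => y; rewrite /tpow expr1 divr1; case: ifPn => [y0|].
    by rewrite ger0_norm//; field.
  by rewrite -ltNge => y0; rewrite ltr0_norm// subrr mulr0.
apply: cvgM; first exact: cvg_cst.
by apply: cvgD; [exact: cvg_id|exact: norm_continuous].
Qed.

Lemma continuous_iter_nabla p F : continuous F -> continuous (iter p nabla F).
Proof.
move=> cF; elim: p => [//|p IH] x.
rewrite iterS /nabla; apply: cvgB; first exact: IH.
apply: (cvg_comp (fun y : R => y - 1) (iter p nabla F)); last exact: IH.
by apply: cvgB; [exact: cvg_id|exact: cvg_cst].
Qed.

Lemma is_derive_iter_nabla p F G x : (forall y : R, is_derive y (1 : R) F (G y)) ->
  is_derive x (1 : R) (iter p nabla F) (iter p nabla G x).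
Proof.
move=> FG; elim: p x => [//|p IH] x; rewrite 2!iterS {2}/nabla.
have dshift : is_derive x 1 (iter p nabla F \o (fun y : R => y - 1))
    (iter p nabla G (x - 1)).
  have dsub : is_derive x (1 : R) (fun y : R => y - 1) (1 : R).
    by apply: is_derive_eq; rewrite subr0.
  have := @is_derive1_comp R (iter p nabla F) (fun y => y - 1) x _ _ (IH _) dsub.
  by rewrite mulr1.
exact: is_deriveB (IH x) dshift.
Qed.

Lemma measurable_iter_tpow p m : measurable_fun setT (iter p nabla (@tpow R m)).
Proof.
elim: p => [|p IH].
  apply: measurable_fun_ifT => //; last by apply: measurable_funM => //;
    exact: measurable_funX.
  exact: measurable_fun_ler.
rewrite iterS /nabla; apply: measurable_funB => //.
by apply: measurableT_comp => //; exact: measurable_funB.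
Qed.

End TruncatedPowers.

(** * Sums of independent uniform variables *)

Section IrwinHall.
Variable R : realType.
Local Notation mu := (@lebesgue_measure R).

Definition irwin_hall_cdf p : R -> R := iter p nabla (tpow p).

Lemma continuous_irwin_hall_cdf p : continuous (irwin_hall_cdf p.+1).
Proof. exact/continuous_iter_nabla/continuous_tpow. Qed.

(** The function of [u] mapped to [- H (x - u)], for [H] a primitive of the
    distribution function, is a primitive of the integrand. *)
Lemma integral_irwin_hall_cdf p x :
  (\int[mu]_(u in `[0%R, 1%R]) (irwin_hall_cdf p.+1 (x - u))%:E =
   (irwin_hall_cdf p.+2 x)%:E)%E.
Proof.
pose H : R -> R := iter p.+1 nabla (tpow p.+2).
pose F (u : R) : R := - H (x - u).
have dF (u : R) : is_derive u (1 : R) F (irwin_hall_cdf p.+1 (x - u)).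
  have dsub : is_derive u (1 : R) (fun y : R => x - y) (-1 : R).
    apply: (is_derive_eq (is_deriveB (is_derive_cst x u (1 : R))
      (is_derive_id u (1 : R)))).
    by rewrite sub0r.
  have dH : is_derive (x - u) (1 : R) H (irwin_hall_cdf p.+1 (x - u)).
    by apply: is_derive_iter_nabla => y; exact: is_derive_tpow.
  have := is_deriveN (@is_derive1_comp R H (fun y => x - y) u _ _ dH dsub).
  by rewrite mulrN1 opprK.
have cF : continuous F.
  by move=> u; apply/differentiable_continuous/derivable1_diffP; have [] := dF u.
rewrite (@continuous_FTC2 _ _ F)//.
- rewrite /F subr0 -EFinB opprK addrC; congr EFin.
- apply: continuous_subspaceT => u.
  apply: (cvg_comp (fun u : R => x - u)); last exact: continuous_irwin_hall_cdf.
  by apply: cvgB; [exact: cvg_cst|exact: cvg_id].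
- split; [by move=> u _; have [] := dF u|..].
    exact/cvg_at_right_filter/cF.
  exact/cvg_at_left_filter/cF.
- by move=> u _; rewrite derive1E; have [_ ->] := dF u.
Qed.

Lemma ge0_integral_uniform_rv d (T : measurableType d) (P : probability T R)
    (X : {RV P >-> R}) (f : R -> R) :
  (forall A, measurable A -> distribution P X A = uniform_prob (@ltr01 R) A) ->
  measurable_fun setT f -> (forall x, 0 <= f x) ->
  (\int[P]_w (f (X w))%:E = \int[mu]_(u in `[0%R, 1%R]) (f u)%:E)%E.
Proof.
move=> XU mf f0; pose Y : T -> measurableTypeR R := X.
have mY : measurable_fun setT Y by exact: (measurable_funPT X).
have mf' : measurable_fun setT (fun x : measurableTypeR R => (f x)%:E).
  exact/measurable_EFinP.
transitivity (\int[pushforward P Y]_x (f x)%:E)%E.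
  by rewrite ge0_integral_pushforward// => y _; rewrite lee_fin.
transitivity (\int[uniform_prob (@ltr01 R)]_x (f x)%:E)%E.
  by apply: eq_measure_integral => A mA _; exact: XU.
by rewrite integral_uniform// subr0 invr1 mul1e.
Qed.

Lemma uniform_cdf x :
  uniform_prob (@ltr01 R) `]-oo, x] = (irwin_hall_cdf 1 x)%:E.
Proof.
rewrite /uniform_prob integral_uniform_pdf.
rewrite (eq_integral (fun=> 1%E)); last first.
  by move=> y; rewrite inE/= => -[_]; rewrite in_itv/= /uniform_pdf => ->;
    rewrite subr0 invr1.
rewrite integral_cst//=; last exact: measurableI.
rewrite mul1e /irwin_hall_cdf/= /nabla /tpow !expr1 !divr1 subr_ge0.
have [x0|x0] := ltP x 0.
  rewrite (_ : _ `&` _ = set0) ?measure0; last first.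
    by apply/seteqP; split => // y [] /=; rewrite !in_itv/=; lra.
  by rewrite leNgt (lt_trans x0)//= subr0.
have [x1|x1] := leP 1 x.
  rewrite (_ : _ `&` _ = `[0, 1]%classic); last first.
    by apply/seteqP; split => y /=; rewrite !in_itv/=; lra.
  rewrite lebesgue_measure_itv/= lte01 oppr0 adde0; congr EFin; ring.
rewrite (_ : _ `&` _ = `[0, x]%classic); last first.
  by apply/seteqP; split => y /=; rewrite !in_itv/=; lra.
rewrite lebesgue_measure_itv/= lte_fin; have [//|x0'] := ltP 0 x.
have -> : x = 0 by lra.
by rewrite subr0.
Qed.

(** By [rv_pair_law], conditioning on the first variable shifts the argument of
    the distribution function of the sum of the others. *)
Lemma irwin_hall_cdfP d (T : measurableType d) (P : probability T R)
    (I : choiceType) (U : I -> {RV P >-> R}) (s : seq I) x :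
  iid U (uniform_prob (@ltr01 R)) -> uniq s -> (0 < size s)%N ->
  P ((fun w => \sum_(i <- s) U i w) @^-1` `]-oo, x]) =
  (irwin_hall_cdf (size s) x)%:E.
Proof.
move=> [indU lawU].
have mop : measurable_fun setT (fun x : R * R => x.1 + x.2).
  exact: measurable_funD.
have mg : forall i : I, measurable_fun setT (@id R) by [].
elim: s x => [//|i s IH] x us _.
have [s0|s0] := posnP (size s).
  rewrite (size0nil s0)/= -uniform_cdf -(lawU i)//.
  by congr (P _); apply/funext => w; rewrite /preimage/= big_seq1.
have us' : uniq s by case/andP: us.
pose C := [set z : R * R | z.1 + z.2 <= x].
have mC : measurable C.
  have := mop measurableT `]-oo, x]%classic (measurable_itv _).
  by rewrite setTI; congr (measurable _); apply/seteqP; split => z /=;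
    rewrite in_itv.
transitivity (P (rv_pair U +%R 0 (fun=> id) i s @^-1` C)).
  by congr (P _); apply/funext => w; rewrite /preimage/= big_cons in_itv.
rewrite (rv_pair_law 0 mop mg indU us mC) /product_measure1.
have W_cdf u : P (fold_rv U +%R 0 (fun=> id) s @^-1` xsection C u) =
    (irwin_hall_cdf (size s) (x - u))%:E.
  rewrite -IH//; congr (P _); apply/funext => w; rewrite /preimage/=.
  by rewrite in_itv/= lerBrDl /xsection/= inE.
under eq_integral do rewrite /= /distribution /pushforward W_cdf.
have F0 y : 0 <= irwin_hall_cdf (size s) y by rewrite -lee_fin -IH.
rewrite [size (i :: s)]/=; case: (size s) s0 F0 => // p _ F0.
have mF : measurable_fun setT (fun u : R => irwin_hall_cdf p.+1 (x - u)).
  apply: measurableT_comp; last exact: measurable_funB.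
  exact: measurable_iter_tpow.
have mFE : measurable_fun setT (fun u : R => (irwin_hall_cdf p.+1 (x - u))%:E).
  exact/measurable_EFinP.
rewrite ge0_integral_distribution//; last by move=> u; rewrite lee_fin.
rewrite (@ge0_integral_uniform_rv _ _ _ _ (fun u => irwin_hall_cdf p.+1 (x - u)))//.
  exact: integral_irwin_hall_cdf.
exact: lawU.
Qed.

(** [F + e *: id] is strictly increasing for every [e > 0], so its derivative
    [f + e] is nonnegative. *)
Lemma ge0_derivative_nondecreasing (F f : R -> R) x :
  (forall y : R, is_derive y (1 : R) F (f y)) ->
  {homo F : y z / y <= z} -> 0 <= f x.
Proof.
move=> dF ndF; apply/ler_addgt0Pr => e e0.
have dG (y : R) : is_derive y (1 : R) (F + e *: id) (f y + e).
  apply: (is_derive_eq (is_deriveD (dF y) (is_deriveZ e (is_derive_id y (1 : R))))).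
  by rewrite /GRing.scale/= mulr1.
have [_ <-] := dG x; rewrite -derive1E.
apply: (@incr_derive1_ge0 _ _ setT).
- by move=> y _; have [] := dG y.
- by move=> y z _ _ yz; rewrite ler_ltD ?ndF ?ltW// /GRing.scale/= ltr_pM2l.
- by rewrite interiorT.
Qed.

(** By the fundamental theorem of calculus, the law of [Z] and the measure of
    density [f] agree on the intervals ]a, b], which generate the Borel sets. *)
Lemma density_of_cdf d (T : measurableType d) (P : probability T R) (Z : T -> R)
    (F f : R -> R) :
  measurable_fun setT Z -> continuous f -> (forall x, 0 <= f x) ->
  (forall x : R, is_derive x (1 : R) F (f x)) ->
  (forall x, P (Z @^-1` `]-oo, x]) = (F x)%:E) ->
  forall A, measurable A -> P (Z @^-1` A) = (\int[mu]_(x in A) (f x)%:E)%E.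
Proof.
move=> mZ cf f0 dF cdfE.
have mf : measurable_fun setT (EFin \o f).
  by apply/measurable_EFinP; exact: continuous_measurable_fun.
have cF : continuous F.
  by move=> u; apply/differentiable_continuous/derivable1_diffP; have [] := dF u.
have ZP : (Z : T -> measurableTypeR R) \in mfun by exact: mem_set.
pose Y : {mfun T >-> measurableTypeR R} := mfun_Sub ZP.
pose nu A := (\int[mu]_(x in A) (f x)%:E)%E.
have nu0 : nu set0 = 0%E by rewrite /nu integral_set0.
have nu_ge0 A : (0 <= nu A)%E by apply: integral_ge0 => x _; rewrite lee_fin.
have nu_sigma : semi_sigma_additive nu.
  move=> A mA tA mUA; apply: cvg_toP.
    apply: ereal_nondecreasing_is_cvgn => m n mn.
    by apply: lee_sum_nneg_natr => // k _ _.
  by rewrite /nu ge0_integral_bigcup//= => [|x _];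
    [exact: measurable_funTS|rewrite lee_fin].
pose nuM : {measure set (measurableTypeR R) -> \bar R} :=
  HB.pack nu (isMeasure.Build _ _ _ nu nu0 nu_ge0 nu_sigma).
move=> A mA; change (distribution P Y A = nuM A).
pose g (n : nat) : set (measurableTypeR R) := `](- n%:R)%R, n%:R]%classic.
apply: (@measure_unique _ R (measurableTypeR R) (@ocitv R) g erefl (@ocitvI R) _ _
  (distribution P Y) nuM _ _ A mA) => //.
- by move=> n; exact: is_ocitv.
- by rewrite /g bigcup_itvT.
- move=> _ [[a b] _ <-] /=.
  have [ab|ba] := ltP a b; last by rewrite set_itv_ge ?measure0// bnd_simp -leNgt.
  rewrite /nu integral_itv_obnd_cbnd; last exact: measurable_funTS.
  rewrite (continuous_FTC2 ab (F := F)).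
  + rewrite (_ : `]a, b]%classic = `]-oo, b] `\` `]-oo, a]); last first.
      by apply/seteqP; split => x /=; rewrite !in_itv/=; lra.
    rewrite measureD//; last by rewrite (le_lt_trans (probability_le1 _ _))// ltry.
    rewrite (_ : _ `&` _ = `]-oo, a]%classic); first by rewrite -!cdfE.
    by apply/seteqP; split => x /=; rewrite !in_itv/=; lra.
  + exact: continuous_subspaceT.
  + split; [by move=> u _; have [] := dF u|..].
      exact/cvg_at_right_filter/cF.
    exact/cvg_at_left_filter/cF.
  + by move=> u _; rewrite derive1E; have [_ ->] := dF u.
- move=> n; apply: (@le_lt_trans _ _ 1%E); last exact: ltry.
  by apply: probability_le1; exact: measurable_itv.
Qed.

End IrwinHall.

(** * The two statements *)

(** For [p >= 2] the density is continuous and is the derivative of the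
    distribution function; it is nonnegative because that function increases.
    For [p = 1] the density is discontinuous, and it differs from the uniform
    density at the point 1 only. *)
Lemma iid_uniform_density (R : realType) p d (T : measurableType d)
    (P : probability T R) (U : 'I_p -> {RV P >-> R}) :
  (0 < p)%N -> iid U (uniform_prob (@ltr01 R)) ->
  is_density P (fun w => \sum_(i < p) U i w) (sum_uniform_pdf p).
Proof.
move=> p0 iidU; have [indU lawU] := iidU.
have pdfE : sum_uniform_pdf p = iter p nabla (tpow p.-1) :> (R -> R).
  by apply/funext => x; rewrite sum_uniform_pdfE.
have mpdf : measurable_fun setT (@sum_uniform_pdf R p).
  by rewrite pdfE; exact: measurable_iter_tpow.
have mS : measurable_fun setT (fun w => \sum_(i < p) U i w).
  by apply: measurable_sum => i; exact: measurable_funPT.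
case: p p0 U iidU indU lawU pdfE mpdf mS =>
  [//|[|p]] _ U iidU indU lawU pdfE mpdf mS.
  have pdf1 x : x != 1 -> sum_uniform_pdf 1 x = uniform_pdf 0 1 x :> R.
    move=> x1; rewrite pdfE /= /nabla /tpow !expr0 !divr1 subr_ge0 /uniform_pdf.
    rewrite subr0 invr1; case: (ltgtP x 1) x1 => // x1 _;
      first by rewrite subr0 andbT.
    by rewrite (le_trans ler01 (ltW x1)) subrr andbF.
  split => //.
    move=> x; have [->|x1] := eqVneq x 1; last by rewrite pdf1// uniform_pdf_ge0.
    by rewrite pdfE /= /nabla /tpow ler01 subrr lexx !expr0 divr1 subrr.
  move=> A mA; transitivity (uniform_prob (@ltr01 R) A).
    rewrite -(lawU ord0)//; congr (P _); apply/funext => w.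
    by rewrite /preimage/= big_ord1.
  rewrite /uniform_prob; apply: ae_eq_integral => //.
  - by apply/measurable_EFinP/measurable_funTS; exact: measurable_uniform_pdf.
  - by apply/measurable_EFinP/measurable_funTS.
  - exists [set 1]; split => //; first exact: lebesgue_measure_set1.
    move=> x /= nx; apply/eqP/negPn/negP => x1; apply: nx => _.
    by rewrite pdf1.
have cdfE x : P ((fun w => \sum_(i < p.+2) U i w) @^-1` `]-oo, x]) =
    (irwin_hall_cdf p.+2 x)%:E.
  have sz : size (index_enum 'I_p.+2) = p.+2.
    by rewrite [index_enum _]unlock -enumT size_enum_ord.
  by rewrite (irwin_hall_cdfP x iidU (index_enum_uniq _)) sz.
have dF (x : R) : is_derive x (1 : R) (irwin_hall_cdf p.+2)
  (sum_uniform_pdf p.+2 x).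
  by rewrite pdfE; apply: is_derive_iter_nabla => y; exact: is_derive_tpow.
have pdf0 x : 0 <= sum_uniform_pdf p.+2 x :> R.
  apply: (ge0_derivative_nondecreasing x dF) => y z yz.
  rewrite -lee_fin -!cdfE le_measure ?inE//.
  - by rewrite -[X in measurable X]setTI; exact: mS.
  - by rewrite -[X in measurable X]setTI; exact: mS.
  - by move=> w /=; rewrite !in_itv/= => /le_trans; exact.
split => //.
apply: (density_of_cdf (F := irwin_hall_cdf p.+2)) => //.
by rewrite pdfE; apply: continuous_iter_nabla; exact: continuous_tpow.
Qed.

Lemma variance_trace_cvg (R : realType) p d (T : measurableType d)
    (P : probability T R) (X : nat -> {RV P >-> R}) :
  (0 < p)%N -> iid X (normal_prob (0 : R) 1) ->
  (fun n : nat =>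
     'V_P[fun w => \tr (circulant n (fun k => X k w) ^+ p)]
       / (n%:R ^+ p.+1)%:E)%E @ \oo --> (p`!%:R : R)%:E.
Proof.
move=> p0 [indX lawX].
have moments i k : has_mean P (fun w => X i w ^+ k) (gaussian_moment R k).
  by apply: has_mean_gaussian => A mA; exact: lawX.
have [K Kn] := sum_moment_cov_asymptotics (gaussian_moment0 R) (gaussian_moment1 R)
  (gaussian_moment2 R) p0.
pose v n : R := n.+1%:R ^+ 2 * \sum_(f in null_sums p n) \sum_(g in null_sums p n)
      moment_cov (gaussian_moment R) f g.
have nn0 k n : n.+1%:R ^+ k != 0 :> R by rewrite expf_neq0// pnatr_eq0.
rewrite -cvg_shiftS /=.
rewrite (_ : (fun n => _) = EFin \o (fun n => v n / n.+1%:R ^+ p.+1)); last first.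
  apply/funext => n /=; rewrite (variance_trace indX moments).
  by rewrite inver (negbTE (nn0 _ _)) -EFinM.
apply: cvg_EFin; first by near=> n.
have vK n : `|v n / n.+1%:R ^+ p.+1 - p`!%:R| <= K * harmonic n.
  have n0 : 0 < n.+1%:R ^+ p.+1 :> R by rewrite exprn_gt0.
  have -> : v n / n.+1%:R ^+ p.+1 - p`!%:R =
      (v n - p`!%:R * n.+1%:R ^+ p.+1) / n.+1%:R ^+ p.+1.
    by rewrite mulrBl mulfK.
  rewrite normrM normfV (gtr0_norm n0) ler_pdivrMr//.
  rewrite (le_trans (Kn n))// /harmonic exprS -mulrA [n.+1%:R^-1 * _]mulrA.
  by rewrite mulVf ?mul1r// pnatr_eq0.
apply: (@squeeze_cvgr _ _ _ _ (fun n => p`!%:R - K * harmonic n)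
                              (fun n => p`!%:R + K * harmonic n)).
- by near=> n; rewrite -ler_distl vK.
- rewrite -[X in _ --> X]subr0 -(mulr0 K); apply: cvgB; first exact: cvg_cst.
  by apply: cvgM; [exact: cvg_cst|exact: cvg_harmonic].
- rewrite -[X in _ --> X]addr0 -(mulr0 K); apply: cvgD; first exact: cvg_cst.
  by apply: cvgM; [exact: cvg_cst|exact: cvg_harmonic].
Unshelve. all: end_near. Qed.

Theorem theorem4 (R : realType) (p : nat) (hp : (0 < p)%N) :
  (forall (d : measure_display) (T : measurableType d) (P : probability T R)
     (X : nat -> {RV P >-> R}),
     iid X (normal_prob 0 1) ->
     (fun n : nat =>
        'V_P[fun w => \tr (circulant n (fun k => X k w) ^+ p)]
          / (n%:R ^+ p.+1)%:E)%E @ \oo -->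
     (p`!%:R * \sum_(0 <= s < p) sum_uniform_pdf p s%:R)%:E)
  /\
  (forall (d : measure_display) (T : measurableType d) (P : probability T R)
     (U : 'I_p -> {RV P >-> R}),
     iid U (uniform_prob ltr01) ->
     is_density P (fun w => \sum_(i < p) U i w) (sum_uniform_pdf p)).
Proof.
split=> d T P; last by move=> U iidU; exact: iid_uniform_density.
by move=> X iidX; rewrite sum_sum_uniform_pdf// mulr1; exact: variance_trace_cvg.
Qed.
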